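(* Let $\Omega=\{(\tau(C),\phi(C),\beta(C)):C\in\mathcal{C}\}\subseteq\mathbb{R}^3$, where $\mathcal{C}$ is the class of all bivariate copulas and $\tau,\phi,\beta$ are Kendall's tau, Spearman's footrule and Blomqvist's beta. Then the volume (three-dimensional Lebesgue measure) of $\Omega$ is $$\operatorname{vol}(\Omega)=\frac{31}{40}.$$
   Context: A (bivariate) copula is a distribution function $C$ on $[0,1]^2$ with uniform marginals; it induces a probability measure on $[0,1]^2$, and integrals $\int \cdot\,\mathrm{d}C$ are Lebesgue--Stieltjes integrals with respect to this measure. For a copula $C$: Kendall's tau is $\tau(C)=4\int_{[0,1]^2}C(u,v)\,\mathrm{d}C(u,v)-1$; Spearman's footrule is $\phi(C)=6\int_0^1 C(u,u)\,\mathrm{d}u-2$; Blomqvist's beta is $\beta(C)=4C(\tfrac12,\tfrac12)-1$. *)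

(* Defs.v *)
From HB Require Import structures.
From mathcomp Require Import all_boot all_order all_algebra.
From mathcomp Require Import all_classical all_reals all_analysis.
Import Order.TTheory GRing.Theory Num.Theory.
Import numFieldNormedType.Exports.

Set Implicit Arguments.
Unset Strict Implicit.
Unset Printing Implicit Defensive.

Local Open Scope classical_set_scope.
Local Open Scope ring_scope.

(* The induced probability measure dC is carried along with the distribution
   function C.  It is determined by C: taking u = v = 1 shows that it is
   concentrated on [0,1]^2, and the rectangles [0,u] x [0,v] form a pi-system
   generating the Borel subsets of [0,1]^2.  Only the values of C on [0,1]^2
   are meaningful. *)
Record copula (R : realType) := Copula {
  copula_fun :> R -> R -> R ;
  copula_measure : probability (measurableTypeR R * measurableTypeR R)%type R ;
  copula_measureE : forall u v : R, 0 <= u <= 1 -> 0 <= v <= 1 ->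
    copula_measure (`[0, u] `*` `[0, v]) = (copula_fun u v)%:E ;
  copula_marginal1 : forall u : R, 0 <= u <= 1 -> copula_fun u 1 = u ;
  copula_marginal2 : forall v : R, 0 <= v <= 1 -> copula_fun 1 v = v }.

Definition kendall_tau (R : realType) (C : copula R) : R :=
  4 * (\int[copula_measure C]_(x in `[0, 1] `*` `[0, 1]) C x.1 x.2) - 1.

Definition spearman_footrule (R : realType) (C : copula R) : R :=
  6 * (\int[lebesgue_measure]_(u in `[0, 1]) C u u) - 2.

Definition blomqvist_beta (R : realType) (C : copula R) : R :=
  4 * C (1 / 2) (1 / 2) - 1.

Definition Omega (R : realType) :
    set (measurableTypeR R * measurableTypeR R * measurableTypeR R) :=
  [set (kendall_tau C, spearman_footrule C, blomqvist_beta C)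
    | C in [set: copula R]].
Arguments Omega R : clear implicits.

(* The library only equips products of measurable spaces, here R * R * R,
   with a product measure; it agrees with three-dimensional Lebesgue measure
   on Borel sets. *)
Definition volume (R : realType) :
    set (measurableTypeR R * measurableTypeR R * measurableTypeR R) -> \bar R :=
  (lebesgue_measure \x lebesgue_measure \x lebesgue_measure)%E.

(* Main.v *)
Require Import Defs.
From HB Require Import structures.
From mathcomp Require Import all_boot all_order all_algebra.
From mathcomp Require Import all_classical all_reals all_analysis.
From mathcomp Require Import measurable_realfun random_variable uniform_distribution.
From mathcomp Require Import ring lra.
Import Order.TTheory GRing.Theory Num.Theory.
Import numFieldNormedType.Exports.
Local Open Scope classical_set_scope.
Local Open Scope ring_scope.

Set Implicit Arguments.
Unset Strict Implicit.
Unset Printing Implicit Defensive.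

(** Let (U, V) be distributed according to C, m = min(U, V), M = max(U, V) and
F(t) = P(M <= t) = C(t, t).  Since tau = 4 E C(U, V) - 1, phi = 6 int F - 2 and
beta = 4 F(1/2) - 1, one has to find the range of (E C(U, V), int F, F(1/2)).
From F(m) <= C(U, V) <= m, E m = int F and E F(m) = 2 int F - 1/2 one gets
2 int F - 1/2 <= E C(U, V) <= int F; the last identity comes from
F(m) + F(M) = F(U) + F(V), where E F(U) = E F(V) = int F and E F(M) = 1/2.
As F is nondecreasing and 2-Lipschitz with F(t) <= t and F(1) = 1, fixing
F(1/2) = d forces 1/4 + d^2/2 <= int F <= 1/2 - (1/2 - d)^2.

Conversely, for 0 <= a <= d <= 1/2 there are two shuffles of [0,1] with the
same F(1/2) = d and int F = 1/4 + d^2/2 + a(1 - d) - a^2/2, one attaining each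
bound on E C(U, V): off the diagonal, the one with E C(U, V) = int F is supported
on two increasing chains, one on each side of the diagonal, and the other one on
nested decreasing segments.  Mixing the two keeps int F and F(1/2), and E C(U, V)
varies continuously, so every intermediate value is attained.  The volume of the
resulting semialgebraic set is a polynomial integral. *)

(** * Distribution functions of the coordinates and of their maximum *)

(** The integrand is kept as a formal derivative, so that an integral reduces to two evaluations of
    an explicit primitive; the affine integrals and the final volume are both computed this way. *)
Lemma integral_deriv_poly (R : realType) (p : {poly R}) (a b : R) : a <= b ->
  (\int[lebesgue_measure]_(x in `[a, b]) (p^`().[x])%:E = (p.[b] - p.[a])%:E)%E.
Proof.
rewrite le_eqVlt => /predU1P[->|ab].
  by rewrite set_itv1 integral_set1 subrr.
rewrite (continuous_FTC2 ab (F := horner p)) ?EFinB//.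
- by apply: continuous_subspaceT; exact: continuous_horner.
- split; first by move=> x _; exact: derivable_horner.
  + by apply: cvg_at_right_filter; exact: continuous_horner.
  + by apply: cvg_at_left_filter; exact: continuous_horner.
- by move=> x _; rewrite derivE.
Qed.

Lemma integral_affine (R : realType) (p q a b : R) : a <= b ->
  (\int[lebesgue_measure]_(x in `[a, b]) (p * x + q)%:E =
   (p * (b ^+ 2 - a ^+ 2) / 2 + q * (b - a))%:E)%E.
Proof.
move=> ab.
transitivity (\int[lebesgue_measure]_(x in `[a, b])
    ((p / 2 *: 'X^2 + q *: 'X : {poly R})^`().[x])%:E)%E.
  apply: eq_integral => x _; congr (_%:E).
  by rewrite !(derivD, derivZ, derivXn, derivX) !hornerE /= ?expr1; lra.
rewrite integral_deriv_poly// !(hornerD, hornerZ, hornerXn, hornerX).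
by congr (_%:E); lra.
Qed.

(** * Tonelli exchange between a distribution function and a tail *)

Section Swap.
Context d (T : measurableType d) (R : realType).
Local Open Scope ereal_scope.
Variables (P : {sigma_finite_measure set T -> \bar R}).
Variable nu : {sigma_finite_measure set (measurableTypeR R) -> \bar R}.
Variable X : T -> measurableTypeR R.
Hypothesis mX : measurable_fun [set: T] X.

Let A := [set z : measurableTypeR R * T | (X z.2 <= z.1)%R].

Let mA : measurable A.
Proof.
rewrite -[A]setTI; apply: (@measurable_fun_le _ _ R setT (X \o snd) fst) => //.
exact: measurableT_comp.
Qed.

Lemma measurable_cdf : measurable_fun setT (fun t : R => P (X @^-1` `]-oo, t])).
Proof.
have := measurable_fun_xsection P mA; congr measurable_fun.
apply/funext => t; congr (P _); apply/seteqP; split => x /=;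
by rewrite /xsection /= inE /A /= in_itv.
Qed.

Lemma measurable_tail :
  measurable_fun setT (fun x => nu `[X x, +oo[%classic).
Proof.
have := measurable_fun_ysection nu mA; congr measurable_fun.
apply/funext => x; congr (nu _); apply/seteqP; split => t /=;
by rewrite /ysection /= inE /A /= in_itv /= andbT.
Qed.

(** Tonelli for the set of pairs (t, x) with X x <= t, whose sections are {X <= t} and [X x, +oo[.
    With nu uniform on [0,1] it turns the integral of a distribution function into an expectation;
    with nu the law of a second variable it computes the expectation of a distribution function at
    that variable. *)
Lemma integral_cdf_swap :
  \int[nu]_t P (X @^-1` `]-oo, t]) = \int[P]_x nu `[X x, +oo[%classic.
Proof.
have := indic_fubini_tonelli nu P mA.
rewrite indic_fubini_tonelli_FE// indic_fubini_tonelli_GE// => E.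
transitivity (\int[nu]_t (P \o xsection A) t).
  apply: eq_integral => t _; congr (P _); apply/seteqP; split => x /=;
  by rewrite /xsection /= inE /A /= in_itv.
rewrite E; apply: eq_integral => t _; congr (nu _); apply/seteqP; split => x /=;
by rewrite /ysection /= inE /A /= in_itv /= andbT.
Qed.

End Swap.

Section Bivariate.
Variable R : realType.
Local Notation RR := (measurableTypeR R).
Variable mu : probability (RR * RR)%type R.

Definition unit_square : set (RR * RR) := `[0, 1] `*` `[0, 1].
(** Unbounded quadrants make monotonicity and measurability hold on the whole plane; [joint_cdfE]
    recovers the rectangles with corner at the origin. *)
Definition joint_cdf (z : RR * RR) : \bar R := mu (`]-oo, z.1] `*` `]-oo, z.2]).
Definition coord_max (z : RR * RR) : RR := Num.max z.1 z.2.
Definition coord_min (z : RR * RR) : RR := Num.min z.1 z.2.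
Definition diag_cdf (t : R) : \bar R := mu (coord_max @^-1` `]-oo, t]).

Definition uniform_marginals :=
  (forall u : R, 0 <= u <= 1 -> mu (`[0, u] `*` `[0, 1]) = u%:E) /\
  (forall v : R, 0 <= v <= 1 -> mu (`[0, 1] `*` `[0, v]) = v%:E).

Lemma measurable_unit_square : measurable unit_square.
Proof. by apply: measurableX; exact: measurable_itv. Qed.

Lemma measurable_coord_max : measurable_fun setT coord_max.
Proof. by apply: measurable_maxr; [exact: measurable_fst|exact: measurable_snd]. Qed.

Lemma measurable_coord_min : measurable_fun setT coord_min.
Proof. by apply: measurable_minr; [exact: measurable_fst|exact: measurable_snd]. Qed.

Lemma diag_cdfE t : diag_cdf t = joint_cdf (t, t).
Proof.
congr (mu _); apply/seteqP; split => -[x y] /=; rewrite !in_itv /= /coord_max /= ge_max.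
  by move=> /andP[].
by move=> [-> ->].
Qed.

Lemma measurable_joint_cdf : measurable_fun setT joint_cdf.
Proof.
pose A := [set w : (RR * RR) * (RR * RR) | w.2.1 <= w.1.1] `&`
          [set w : (RR * RR) * (RR * RR) | w.2.2 <= w.1.2].
have mA : measurable A.
  apply: measurableI; rewrite -[X in measurable X]setTI;
  apply: measurable_fun_le => //; apply: measurableT_comp => //.
have := measurable_fun_xsection mu mA.
rewrite (_ : _ \o _ = joint_cdf)//; apply/funext => -[x y]; congr (mu _).
apply/seteqP; split => -[a b]; rewrite /xsection /= inE /A /= !in_itv /= => -[] //.
Qed.

Lemma measurable_diag_cdf : measurable_fun setT diag_cdf.
Proof.
exact: (measurable_cdf mu measurable_coord_max).
Qed.

Hypothesis unif : uniform_marginals.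

Lemma mu_unit_square : mu unit_square = 1%E.
Proof. by rewrite unif.1 // lexx ler01. Qed.

Lemma mu_setC_unit_square : mu (~` unit_square) = 0%E.
Proof.
rewrite probability_setC ?mu_unit_square ?subee//.
exact: measurable_unit_square.
Qed.

Lemma mu_setI_unit_square A : measurable A -> mu (A `&` unit_square) = mu A.
Proof.
move=> mA; have mS := measurable_unit_square.
rewrite [RHS](measureDI mu mA mS) [X in (_ = X + _)%E](_ : _ = 0%E) ?add0e//.
apply: (@subset_measure0 _ _ _ _ _ (~` unit_square)).
- exact: measurableD.
- exact: measurableC.
- by move=> x [].
- exact: mu_setC_unit_square.
Qed.

Lemma ge0_integral_unit_square (f : RR * RR -> \bar R) : measurable_fun setT f ->
  (forall z, 0 <= f z)%E ->
  (\int[mu]_z f z = \int[mu]_(z in unit_square) f z)%E.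
Proof.
move=> mf f0; rewrite (@ge0_negligible_integral _ _ _ _ _ (~` unit_square))//.
- by rewrite setDE setTI setCK.
- exact: measurableC measurable_unit_square.
- exact: mu_setC_unit_square.
Qed.

Lemma joint_cdfE u v : 0 <= u <= 1 -> 0 <= v <= 1 ->
  joint_cdf (u, v) = mu (`[0, u] `*` `[0, v]).
Proof.
move=> /andP[u0 u1] /andP[v0 v1]; rewrite /joint_cdf /= -mu_setI_unit_square; last first.
  by apply: measurableX; exact: measurable_itv.
congr (mu _); apply/seteqP; split => -[x y] /=; rewrite /unit_square /= !in_itv /=.
  by move=> [[-> ->] [/andP[-> _] /andP[-> _]]].
by move=> [/andP[-> xu] /andP[-> yv]]; rewrite xu yv (le_trans xu) ?(le_trans yv).
Qed.

Lemma mu_fst_le u : 0 <= u <= 1 -> mu (fst @^-1` `]-oo, u]) = u%:E.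
Proof.
move=> /andP[u0 u1]; rewrite -(mu_setI_unit_square); last first.
  by rewrite -[X in measurable X]setTI; apply: measurable_fst => //; exact: measurable_itv.
rewrite -unif.1 ?u0//; congr (mu _); apply/seteqP; split => -[x y] /=.
  by rewrite /unit_square /= !in_itv /= => -[-> [/andP[-> _] ->]].
by rewrite /unit_square /= !in_itv /= => -[/andP[-> xu] ->]; rewrite xu (le_trans xu).
Qed.

Lemma mu_snd_le u : 0 <= u <= 1 -> mu (snd @^-1` `]-oo, u]) = u%:E.
Proof.
move=> /andP[u0 u1]; rewrite -(mu_setI_unit_square); last first.
  by rewrite -[X in measurable X]setTI; apply: measurable_snd => //; exact: measurable_itv.
rewrite -unif.2 ?u0//; congr (mu _); apply/seteqP; split => -[x y] /=.
  by rewrite /unit_square /= !in_itv /= => -[-> [-> /andP[-> _]]].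
by rewrite /unit_square /= !in_itv /= => -[-> /andP[-> yu]]; rewrite yu (le_trans yu).
Qed.

Lemma measurable_preimage_itv (X : RR * RR -> RR) (i : interval R) :
  measurable_fun setT X -> measurable (X @^-1` [set` i]).
Proof.
by move=> mX; rewrite -[X in measurable X]setTI; apply: mX => //; exact: measurable_itv.
Qed.

Lemma measurable_preimage_set1 (X : RR * RR -> RR) (t : R) :
  measurable_fun setT X -> measurable (X @^-1` [set t]).
Proof.
by move=> mX; rewrite -[X in measurable X]setTI; apply: mX.
Qed.

Section UniformVariable.
Variable X : RR * RR -> RR.
Hypothesis mX : measurable_fun setT X.
Hypothesis X_unif : forall u : R, 0 <= u <= 1 -> mu (X @^-1` `]-oo, u]) = u%:E.

(** For s < t the events {X = t} and {X <= s} are disjoint inside {X <= t}, so the atom has mass at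
    most t - s, which can be made arbitrarily small. The point t = 0 has no such s in [0,1], but
    there {X <= 0} is itself null. *)
Lemma uniform_atom0 t : 0 <= t <= 1 -> mu (X @^-1` [set t]) = 0%E.
Proof.
move=> /andP[t0 t1]; apply/eqP; rewrite -measure_le0.
have mt := measurable_preimage_set1 t mX.
have [->|tn0] := eqVneq t 0.
  have <- : mu (X @^-1` `]-oo, 0]) = 0%E by rewrite X_unif ?lexx ?ler01.
  rewrite le_measure ?inE//.
  - exact: measurable_preimage_set1.
  - exact: measurable_preimage_itv.
  - by move=> z /= ->; rewrite in_itv /= lexx.
have {t0}tn0 : 0 < t by rewrite lt_neqAle eq_sym tn0.
have fin : mu (X @^-1` [set t]) \is a fin_num by exact: fin_num_measure.
rewrite -[X in (X <= _)%E](fineK fin) lee_fin; apply/ler_addgt0Pr => e e0; rewrite add0r.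
(* Truncation at 0 keeps s in [0,1], where the law of X is known. *)
pose s := Num.max 0 (t - e).
have s0 : 0 <= s by rewrite le_max lexx.
have st : s < t by rewrite gt_max tn0; lra.
have se : t - e <= s by rewrite le_max lexx orbT.
suff : (mu (X @^-1` [set t]) + s%:E <= t%:E)%E.
  by rewrite -[X in (X + _)%E](fineK fin) -EFinD lee_fin; lra.
rewrite -(X_unif (u := s)); last by rewrite s0; lra.
rewrite -measureU//; last 2 first.
- exact: measurable_preimage_itv.
- by apply/seteqP; split => // z /= [->]; rewrite in_itv /=; lra.
rewrite -(X_unif (u := t)); last by lra.
rewrite le_measure ?inE//.
- by apply: measurableU => //; exact: measurable_preimage_itv.
- exact: measurable_preimage_itv.
- by move=> z /= [->|]; rewrite !in_itv /= ?lexx//; lra.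
Qed.

Lemma uniform_tail t : 0 <= t <= 1 -> mu (X @^-1` `[t, +oo[) = (1 - t)%:E.
Proof.
move=> t01; have mt := measurable_preimage_set1 t mX.
have -> : X @^-1` `[t, +oo[ = X @^-1` [set t] `|` ~` (X @^-1` `]-oo, t]).
  apply/seteqP; split => z /=; rewrite !in_itv /= andbT.
    by rewrite le_eqVlt => /orP[/eqP ->|]; [left|right; apply/negP; rewrite -ltNge].
  by move=> [->//|/negP]; rewrite -ltNge => /ltW.
rewrite measureU//; last 2 first.
- by apply: measurableC; exact: measurable_preimage_itv.
- by apply/seteqP; split => // z /= [->]; rewrite in_itv /= lexx.
rewrite [X in (X + _)%E](_ : _ = 0%E); last exact: uniform_atom0.
rewrite add0e; have mc := measurable_preimage_itv `]-oo, t] mX.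
by have := probability_setC mu mc; rewrite X_unif.
Qed.

End UniformVariable.

(** The events {max <= t} and {max >= t} overlap only in {max = t}, which is contained in the union
    of {U = t} and {V = t} and is null because the marginals have no atoms. *)
Lemma max_tail t : 0 <= t <= 1 ->
  (diag_cdf t + mu (coord_max @^-1` `[t, +oo[) = 1)%E.
Proof.
move=> t01; have mt := measurable_preimage_set1 t measurable_coord_max.
have mc := measurable_preimage_itv `]-oo, t] measurable_coord_max.
have -> : coord_max @^-1` `[t, +oo[ =
    coord_max @^-1` [set t] `|` ~` (coord_max @^-1` `]-oo, t]).
  apply/seteqP; split => z /=; rewrite !in_itv /= andbT.
    by rewrite le_eqVlt => /orP[/eqP ->|]; [left|right; apply/negP; rewrite -ltNge].
  by move=> [->//|/negP]; rewrite -ltNge => /ltW.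
rewrite measureU//; last 2 first.
- exact: measurableC.
- by apply/seteqP; split => // z /= [->]; rewrite in_itv /= lexx.
rewrite [X in (_ + (X + _))%E](_ : _ = 0%E) ?add0e.
  transitivity (diag_cdf t + (1 - diag_cdf t))%E.
    by congr (_ + _)%E; exact: probability_setC.
  by rewrite addeC subeK// fin_num_measure.
have mf := measurable_preimage_set1 t measurable_fst.
have ms := measurable_preimage_set1 t measurable_snd.
apply: (@subset_measure0 _ _ _ mu _ (fst @^-1` [set t] `|` snd @^-1` [set t])) => //.
- exact: measurableU.
- by move=> [x y] /=; rewrite /coord_max /=; case: (leP x y) => _; [right|left].
- apply: null_set_setU => //; apply: uniform_atom0 => //.
  + exact: mu_fst_le.
  + exact: mu_snd_le.
Qed.

End Bivariate.

(** * Expectations under the copula measure *)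

Lemma uniform_prob_tail (R : realType) (s : R) : 0 <= s <= 1 ->
  uniform_prob (@ltr01 R) `[s, +oo[ = (1 - s)%:E.
Proof.
move=> /andP[s0 s1]; rewrite /uniform_prob integral_uniform_pdf.
rewrite (_ : `[s, +oo[ `&` `[0, 1] = `[s, 1]%classic); last first.
  apply/seteqP; split => x /=; rewrite !in_itv /= ?andbT.
    by move=> [-> /andP[_ ->]].
  by move=> /andP[sx ->]; rewrite sx (le_trans s0).
rewrite (eq_integral (fun=> 1%E)).
  by rewrite integral_cst//= mul1e lebesgue_measure_itv/= lte_fin; case: ltP => //=;
    rewrite ?EFinB//; move=> ?; congr (_%:E); lra.
move=> x; rewrite inE /= in_itv /= => /andP[sx x1].
by rewrite /uniform_pdf (le_trans s0 sx) x1 /= subr0 invr1.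
Qed.

Section Expectations.
Variable R : realType.
Local Notation RR := (measurableTypeR R).
Local Notation lam := (@lebesgue_measure R).
Variable mu : probability (RR * RR)%type R.
Hypothesis unif : uniform_marginals mu.
Local Notation Sq := (@unit_square R).
Local Notation mS := (@measurable_unit_square R).

Lemma unit_squareP (z : RR * RR) : Sq z -> 0 <= z.1 <= 1 /\ 0 <= z.2 <= 1.
Proof. by move=> []; rewrite /= !in_itv /=. Qed.

Lemma coord_max_01 (z : RR * RR) : Sq z -> 0 <= coord_max z <= 1.
Proof. by move=> /unit_squareP[]; rewrite /coord_max; case: (leP z.1 z.2) => _. Qed.

Lemma coord_min_01 (z : RR * RR) : Sq z -> 0 <= coord_min z <= 1.
Proof. by move=> /unit_squareP[]; rewrite /coord_min; case: (leP z.1 z.2) => _. Qed.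

Lemma integral_unit_square_cst (r : R) : (\int[mu]_(z in Sq) r%:E = r%:E)%E.
Proof.
rewrite integral_cst; last exact: mS.
rewrite [X in (_ * X)%E](_ : _ = 1%E) ?mule1//; exact: mu_unit_square.
Qed.

Section Bounded.
Variable Y : RR * RR -> RR.
Hypothesis mY : measurable_fun setT Y.
Hypothesis Y01 : forall z, Sq z -> 0 <= Y z <= 1.

Lemma integral_1sub :
  (\int[mu]_(z in Sq) (1 - Y z)%:E + \int[mu]_(z in Sq) (Y z)%:E = 1)%E.
Proof.
rewrite -(integral_unit_square_cst 1) -ge0_integralD//.
- by apply: eq_integral => z _; rewrite -EFinD subrK.
- exact: mS.
- by move=> z /Y01; rewrite lee_fin; lra.
- apply/measurable_EFinP; apply: measurable_funTS.
  exact: measurable_funB.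
- by move=> z /Y01; rewrite lee_fin; lra.
- by apply/measurable_EFinP; apply: measurable_funTS.
Qed.

(** The exchange above with nu uniform: the tail of the uniform law at Y z is 1 - Y z. *)
Lemma integral_cdf_unit :
  (\int[lam]_(t in `[0%R, 1%R]) mu (Y @^-1` `]-oo, t]) =
   \int[mu]_(z in Sq) (1 - Y z)%:E)%E.
Proof.
have := integral_cdf_swap mu (uniform_prob (@ltr01 R)) mY.
rewrite integral_uniform//; last exact: measurable_cdf.
rewrite subr0 invr1 mul1e => ->.
rewrite ge0_integral_unit_square//; last exact: (measurable_tail (uniform_prob ltr01) mY).
apply: eq_integral => z; rewrite inE => /Y01 Yz.
exact: uniform_prob_tail.
Qed.

Lemma integral_bounded_fin : (\int[mu]_(z in Sq) (Y z)%:E)%E \is a fin_num.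
Proof.
have i0 : (0 <= \int[mu]_(z in Sq) (Y z)%:E)%E.
  by apply: integral_ge0 => z /Y01; rewrite lee_fin => /andP[].
have i1 : (0 <= \int[mu]_(z in Sq) (1 - Y z)%:E)%E.
  by apply: integral_ge0 => z /Y01; rewrite lee_fin; lra.
rewrite ge0_fin_numE//; have := integral_1sub.
case: (X in (_ + X)%E) i0 => [r||]//= _.
  by rewrite ltry.
by case: (X in (X + _)%E) i1.
Qed.

End Bounded.

Definition diag_integral : \bar R := (\int[lam]_(t in `[0%R, 1%R]) diag_cdf mu t)%E.

Lemma adde_complement (x y : \bar R) (r : R) : (x + y = 1)%E -> x = r%:E -> y = (1 - r)%:E.
Proof.
by move=> /[swap] ->; case: y => // s [<-]; congr (_%:E); lra.
Qed.

Lemma integral_identity_unit : (\int[lam]_(t in `[0%R, 1%R]) t%:E = (1 / 2)%:E)%E.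
Proof.
transitivity (\int[lam]_(t in `[0%R, 1%R]) (1 * t + 0)%:E)%E.
  by apply: eq_integral => t _; rewrite mul1r addr0.
by rewrite integral_affine//; congr (_%:E); lra.
Qed.

Lemma integral_uniform_half (X : RR * RR -> RR) : measurable_fun setT X ->
  (forall z, Sq z -> 0 <= X z <= 1) ->
  (forall u : R, 0 <= u <= 1 -> mu (X @^-1` `]-oo, u]) = u%:E) ->
  (\int[mu]_(z in Sq) (X z)%:E = (1 / 2)%:E)%E.
Proof.
move=> mX X01 hX; have -> : (1 / 2 : R) = 1 - 1 / 2 by lra.
apply: (adde_complement (integral_1sub mX X01)).
rewrite -integral_cdf_unit// -integral_identity_unit.
by apply: eq_integral => t; rewrite inE /= in_itv /= => /hX.
Qed.

Lemma fst_01 (z : RR * RR) : Sq z -> 0 <= z.1 <= 1.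
Proof. by move=> /unit_squareP[]. Qed.

Lemma snd_01 (z : RR * RR) : Sq z -> 0 <= z.2 <= 1.
Proof. by move=> /unit_squareP[]. Qed.

Lemma integral_fst : (\int[mu]_(z in Sq) z.1%:E = (1 / 2)%:E)%E.
Proof.
exact: (integral_uniform_half measurable_fst fst_01 (mu_fst_le unif)).
Qed.

Lemma integral_snd : (\int[mu]_(z in Sq) z.2%:E = (1 / 2)%:E)%E.
Proof.
exact: (integral_uniform_half measurable_snd snd_01 (mu_snd_le unif)).
Qed.

Lemma diag_integral_1sub_max : diag_integral = (\int[mu]_(z in Sq) (1 - coord_max z)%:E)%E.
Proof. exact: (integral_cdf_unit (@measurable_coord_max R) coord_max_01). Qed.

Lemma diag_integral_max : (diag_integral + \int[mu]_(z in Sq) (coord_max z)%:E = 1)%E.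
Proof.
rewrite diag_integral_1sub_max.
exact: (integral_1sub (@measurable_coord_max R) coord_max_01).
Qed.

Lemma diag_integral_fin : diag_integral \is a fin_num.
Proof.
have := diag_integral_max.
by rewrite -(fineK (integral_bounded_fin (@measurable_coord_max R) coord_max_01));
  case: diag_integral.
Qed.

Lemma measurable_EFin_Sq (X : RR * RR -> RR) : measurable_fun setT X ->
  measurable_fun Sq (fun z => (X z)%:E).
Proof. by move=> mX; apply/measurable_EFinP; exact: measurable_funTS. Qed.

(** Since min + max = U + V has expectation 1, the expectation of the minimum is 1 - E max, which is
    the integral of F. *)
Lemma integral_min : (\int[mu]_(z in Sq) (coord_min z)%:E)%E = diag_integral.
Proof.
have : (\int[mu]_(z in Sq) (coord_min z)%:E + \int[mu]_(z in Sq) (coord_max z)%:E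
   = 1)%E.
  rewrite -ge0_integralD//; first last.
  - exact: measurable_EFin_Sq (@measurable_coord_max R).
  - by move=> z /coord_max_01; rewrite lee_fin => /andP[].
  - exact: measurable_EFin_Sq (@measurable_coord_min R).
  - by move=> z /coord_min_01; rewrite lee_fin => /andP[].
  - exact: mS.
  rewrite (eq_integral (fun z : RR * RR => ((z.1 : R)%:E + (z.2 : R)%:E)%E)); last first.
    move=> z _; rewrite -!EFinD /coord_min /coord_max; congr (_%:E).
    by rewrite addr_min_max.
  rewrite ge0_integralD//; first last.
  - exact: measurable_EFin_Sq measurable_snd.
  - by move=> z /snd_01; rewrite lee_fin => /andP[].
  - exact: measurable_EFin_Sq measurable_fst.
  - by move=> z /fst_01; rewrite lee_fin => /andP[].
  - exact: mS.
  by rewrite integral_fst integral_snd -EFinD; congr (_%:E); lra.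
have := diag_integral_max.
have fM := integral_bounded_fin (@measurable_coord_max R) coord_max_01.
have fm := integral_bounded_fin (@measurable_coord_min R) coord_min_01.
rewrite -(fineK fM) -(fineK fm) -(fineK diag_integral_fin) -!EFinD.
move=> [] e1 [] e2; congr (_%:E); lra.
Qed.

(** Both sides are the probability that the maximum of one sample is at most X of another,
    independent sample: the exchange is applied with nu the law of X. *)
Lemma integral_diag_cdf_law (X : RR * RR -> RR) : measurable_fun setT X ->
  (\int[mu]_(z in Sq) diag_cdf mu (X z) =
   \int[mu]_(z in Sq) mu (X @^-1` `[coord_max z, +oo[))%E.
Proof.
move=> mX; pose mX_mixin := isMeasurableFun.Build _ _ _ _ _ mX.
pose X' : {mfun _ >-> _} := HB.pack X mX_mixin.
have := integral_cdf_swap mu (distribution mu X') (@measurable_coord_max R).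
rewrite ge0_integral_distribution//; last exact: measurable_diag_cdf.
rewrite ge0_integral_unit_square//; last first.
  by apply: measurableT_comp => //; exact: measurable_diag_cdf.
move=> ->; rewrite ge0_integral_unit_square//.
exact: (measurable_tail (distribution mu X') (@measurable_coord_max R)).
Qed.

(** A uniform X exceeds the level M with probability 1 - M, and the expectation of 1 - M is the
    integral of F. *)
Lemma integral_diag_cdf_uniform (X : RR * RR -> RR) : measurable_fun setT X ->
  (forall u : R, 0 <= u <= 1 -> mu (X @^-1` `]-oo, u]) = u%:E) ->
  (\int[mu]_(z in Sq) diag_cdf mu (X z) = diag_integral)%E.
Proof.
move=> mX hX; rewrite integral_diag_cdf_law// diag_integral_1sub_max.
apply: eq_integral => z; rewrite inE => /coord_max_01 z01.
exact: uniform_tail.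
Qed.

(* Two independent copies of max(U,V) tie with probability 0. *)
Lemma integral_diag_cdf_max :
  (\int[mu]_(z in Sq) diag_cdf mu (coord_max z) = (1 / 2)%:E)%E.
Proof.
have mM := @measurable_coord_max R.
have m1 : measurable_fun Sq (fun z => diag_cdf mu (coord_max z)).
  apply: measurable_funTS; apply: measurableT_comp => //.
  exact: measurable_diag_cdf.
pose mM_mixin := isMeasurableFun.Build _ _ _ _ _ mM.
pose M' : {mfun _ >-> _} := HB.pack (@coord_max R) mM_mixin.
have m2 : measurable_fun Sq (fun z => mu (coord_max (R:=R) @^-1` `[coord_max z, +oo[)).
  by apply: measurable_funTS; exact: (measurable_tail (distribution mu M') mM).
have : (\int[mu]_(z in Sq) diag_cdf mu (coord_max z) +
        \int[mu]_(z in Sq) diag_cdf mu (coord_max z) = 1)%E.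
  rewrite {2}integral_diag_cdf_law// -ge0_integralD//; last exact: mS.
  rewrite -(integral_unit_square_cst 1); apply: eq_integral => z.
  by rewrite inE => /coord_max_01; exact: max_tail.
case: (integral _ _ _) => //= r [] e; congr (_%:E); lra.
Qed.

Lemma integral_diag_cdf_min :
  (\int[mu]_(z in Sq) diag_cdf mu (coord_min z) + (1 / 2)%:E
   = diag_integral + diag_integral)%E.
Proof.
have mF (X : RR * RR -> RR) : measurable_fun setT X ->
    measurable_fun Sq (fun z => diag_cdf mu (X z)).
  move=> mX; apply: measurable_funTS; apply: measurableT_comp => //.
  exact: measurable_diag_cdf.
rewrite -integral_diag_cdf_max.
rewrite -{1}(integral_diag_cdf_uniform measurable_fst (mu_fst_le unif)).
rewrite -(integral_diag_cdf_uniform measurable_snd (mu_snd_le unif)).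
rewrite -!ge0_integralD//.
- apply: eq_integral => z _; rewrite /coord_min /coord_max.
  by case: (leP z.1 z.2) => _ //; rewrite addeC.
all: try exact: mS.
all: try exact: mF.
- exact: mF (@measurable_coord_min R).
- exact: mF (@measurable_coord_max R).
Qed.

End Expectations.

(** * Inequalities between the three functionals *)

Section Content.
Context d (T : measurableType d) (R : realType) (mu : {measure set T -> \bar R}).

Lemma measureU_le (A B : set T) : measurable A -> measurable B ->
  (mu (A `|` B) <= mu A + mu B)%E.
Proof.
move=> mA mB; have -> : A `|` B = A `|` (B `\` A) by rewrite setUDr setDv setD0.
have mD : measurable (B `\` A) by exact: measurableD.
rewrite measureU//; last by rewrite setDIK.
by rewrite leeD2l// le_measure ?inE//; exact: subDsetl.
Qed.

End Content.

Section PiecewiseBounds.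
Variable R : realType.
Local Notation RR := (measurableTypeR R).
Local Notation lam := (@lebesgue_measure R).
Variable f : RR -> \bar R.
Hypothesis mf : measurable_fun setT f.
Hypothesis f0 : forall x, (0 <= f x)%E.

Lemma integral_itv_split (a b c : R) : a <= b -> b <= c ->
  (\int[lam]_(x in `[a, c]) f x =
   \int[lam]_(x in `[a, b]) f x + \int[lam]_(x in `[b, c]) f x)%E.
Proof.
move=> ab bc; rewrite -(@integral_itv_obnd_cbnd _ b); last exact: measurable_funTS.
rewrite -ge0_integral_setU//=.
- congr (integral _ _ _); apply/seteqP; split => x /=; rewrite !in_itv /=.
    by move=> /andP[-> ->]; rewrite /= andbT; case: (leP x b) => _; [left|right].
  by move=> [/andP[-> xb]|/andP[bx ->]]; [rewrite (le_trans xb)|rewrite (le_trans ab)//= ltW].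
- exact: measurable_funTS.
- apply/disj_setPS => x /= [] ; rewrite !in_itv /= => /andP[_ xb] /andP[bx _].
  by move: bx; rewrite ltNge xb.
Qed.

(** The bound r is kept apart from the integral of the affine minorant, so that each use leaves one
    polynomial inequality. *)
Lemma integral_ge_affine (a b p q r : R) : a <= b ->
  r <= p * (b ^+ 2 - a ^+ 2) / 2 + q * (b - a) ->
  (forall x : R, a <= x <= b -> 0 <= p * x + q /\ ((p * x + q)%:E <= f x)%E) ->
  (r%:E <= \int[lam]_(x in `[a, b]) f x)%E.
Proof.
move=> ab; rewrite -lee_fin => /le_trans + H; apply.
rewrite -(integral_affine p q ab); apply: ge0_le_integral => //.
- by move=> x; rewrite /= in_itv => /H[]; rewrite lee_fin.
- apply/measurable_EFinP; apply: measurable_funTS; apply: measurable_funD => //.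
- exact: measurable_funTS.
- by move=> x; rewrite /= in_itv => /H[].
Qed.

Lemma integral_le_affine (a b p q r : R) : a <= b ->
  p * (b ^+ 2 - a ^+ 2) / 2 + q * (b - a) <= r ->
  (forall x : R, a <= x <= b -> (f x <= (p * x + q)%:E)%E) ->
  (\int[lam]_(x in `[a, b]) f x <= r%:E)%E.
Proof.
move=> ab; rewrite -lee_fin => /(le_trans _) + H; apply.
rewrite -(integral_affine p q ab); apply: ge0_le_integral => //.
- exact: measurable_funTS.
- apply/measurable_EFinP; apply: measurable_funTS; apply: measurable_funD => //.
Qed.

End PiecewiseBounds.

Section Inequalities.
Variable R : realType.
Local Notation RR := (measurableTypeR R).
Variable mu : probability (RR * RR)%type R.
Hypothesis unif : uniform_marginals mu.
Local Notation Sq := (@unit_square R).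

Definition joint_integral : \bar R := (\int[mu]_(z in Sq) joint_cdf mu z)%E.

Lemma measurable_quadrant (z : RR * RR) : measurable (`]-oo, z.1] `*` `]-oo, z.2]).
Proof. by apply: measurableX; exact: measurable_itv. Qed.

Lemma joint_cdf_le (z w : RR * RR) : z.1 <= w.1 -> z.2 <= w.2 ->
  (joint_cdf mu z <= joint_cdf mu w)%E.
Proof.
move=> zw1 zw2; apply: le_measure; rewrite ?inE; [exact: measurable_quadrant..|].
by move=> x /=; rewrite !in_itv /= => -[/le_trans -> // /le_trans ->].
Qed.

Lemma joint_cdf_le1 z : (joint_cdf mu z <= 1)%E.
Proof. by apply: probability_le1; exact: measurable_quadrant. Qed.

Lemma joint_cdf_fin z : joint_cdf mu z \is a fin_num.
Proof. by apply: fin_num_measure; exact: measurable_quadrant. Qed.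

Lemma joint_cdf_le_min z : Sq z -> (joint_cdf mu z <= (coord_min z)%:E)%E.
Proof.
move=> /unit_squareP[z1 z2]; rewrite /coord_min; case: (leP z.1 z.2) => _.
- rewrite -(mu_fst_le unif z1); apply: le_measure; rewrite ?inE.
  + exact: measurable_quadrant.
  + exact: measurable_preimage_itv measurable_fst.
  + by move=> x /= [].
- rewrite -(mu_snd_le unif z2); apply: le_measure; rewrite ?inE.
  + exact: measurable_quadrant.
  + exact: measurable_preimage_itv measurable_snd.
  + by move=> x /= [].
Qed.

Lemma joint_cdf_ge_diag_min z : (diag_cdf mu (coord_min z) <= joint_cdf mu z)%E.
Proof.
rewrite diag_cdfE; apply: joint_cdf_le => /=; rewrite /coord_min;
by case: (leP z.1 z.2) => // /ltW.
Qed.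

Lemma joint_integral_le : (joint_integral <= diag_integral mu)%E.
Proof.
rewrite -integral_min//; apply: ge0_le_integral => //.
- exact: measurable_unit_square.
- by apply: measurable_funTS; exact: measurable_joint_cdf.
- exact: measurable_EFin_Sq (@measurable_coord_min R).
- exact: joint_cdf_le_min.
Qed.

Lemma joint_integral_fin : joint_integral \is a fin_num.
Proof.
rewrite ge0_fin_numE; last exact: integral_ge0.
apply: le_lt_trans joint_integral_le _.
by rewrite ltey_eq diag_integral_fin.
Qed.

(** Integration of C(u, v) >= F(min(u, v)). The additive form avoids subtraction of extended
    reals. *)
Lemma joint_integral_ge :
  (diag_integral mu + diag_integral mu <= joint_integral + (1 / 2)%:E)%E.
Proof.
rewrite -integral_diag_cdf_min// leeD2r//; apply: ge0_le_integral => //.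
- exact: measurable_unit_square.
- apply: measurable_funTS; apply: measurableT_comp; first exact: measurable_diag_cdf.
  exact: measurable_coord_min.
- by apply: measurable_funTS; exact: measurable_joint_cdf.
- by move=> z _; exact: joint_cdf_ge_diag_min.
Qed.

Lemma mu_itv_oc (X : RR * RR -> RR) (s t : R) : measurable_fun setT X ->
  (forall u : R, 0 <= u <= 1 -> mu (X @^-1` `]-oo, u]) = u%:E) ->
  0 <= s -> s <= t -> t <= 1 -> mu (X @^-1` `]s, t]) = (t - s)%:E.
Proof.
move=> mX hX s0 st t1.
have mi i := measurable_preimage_itv i mX.
have E : X @^-1` `]-oo, t] = X @^-1` `]-oo, s] `|` X @^-1` `]s, t].
  apply/seteqP; split => z /=; rewrite !in_itv /=.
    by move=> ->; rewrite andbT; case: (leP (X z) s) => _; [left|right].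
  by move=> [zs|/andP[_ ->]//]; rewrite (le_trans zs).
have : (s%:E + mu (X @^-1` `]s, t]) = t%:E)%E.
  rewrite -(hX t) ?E; last by rewrite t1 (le_trans s0).
  rewrite measureU//; last first.
    apply/seteqP; split => // z /= []; rewrite !in_itv /= => zs /andP[sz _].
    by move: sz; rewrite ltNge zs.
  by congr (_ + _)%E; rewrite -hX// s0 (le_trans st).
by case: (mu _) => // r [] <-; congr (_%:E); lra.
Qed.

Lemma diag_cdf_le t : 0 <= t <= 1 -> (diag_cdf mu t <= t%:E)%E.
Proof.
move=> t01; rewrite diag_cdfE.
have : Sq (t, t) by split; rewrite /= in_itv.
by move=> /joint_cdf_le_min; rewrite /coord_min /= minxx.
Qed.

Lemma diag_cdf_homo s t : s <= t -> (diag_cdf mu s <= diag_cdf mu t)%E.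
Proof. by move=> st; rewrite !diag_cdfE joint_cdf_le. Qed.

Lemma diag_cdf1 : diag_cdf mu 1 = 1%E.
Proof.
by rewrite diag_cdfE joint_cdfE ?lexx ?ler01//; exact: mu_unit_square.
Qed.

(** If the maximum lies in ]s, t], then so does at least one coordinate, and each coordinate does so
    with probability t - s. *)
Lemma diag_cdf_lipschitz s t : 0 <= s -> s <= t -> t <= 1 ->
  (diag_cdf mu t <= diag_cdf mu s + (2 * (t - s))%:E)%E.
Proof.
move=> s0 st t1.
have mi := measurable_preimage_itv _ (@measurable_coord_max R).
have m1 := measurable_preimage_itv `]s, t] (@measurable_fst _ _ RR RR).
have m2 := measurable_preimage_itv `]s, t] (@measurable_snd _ _ RR RR).
have -> : (2 * (t - s))%:E = (mu (fst @^-1` `]s, t]) + mu (snd @^-1` `]s, t]))%E.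
  rewrite (mu_itv_oc measurable_fst (mu_fst_le unif))//.
  by rewrite (mu_itv_oc measurable_snd (mu_snd_le unif))// -EFinD; congr (_%:E); lra.
apply: (@le_trans _ _ (diag_cdf mu s + mu (fst @^-1` `]s, t] `|` snd @^-1` `]s, t]))%E).
  apply: le_trans (measureU_le mu (mi _) (measurableU _ _ m1 m2)).
  apply: le_measure; rewrite ?inE//; first by apply: measurableU => //; exact: measurableU.
  move=> z /=; rewrite !in_itv /= /coord_max !ge_max => /andP[-> ->]; rewrite !andbT.
  by case: (leP z.1 s) => _; case: (leP z.2 s) => _; [left|right;right|right;left|right;left].
by rewrite leeD2l//; exact: measureU_le.
Qed.

Lemma diag_cdf_fin t : diag_cdf mu t \is a fin_num.
Proof. by rewrite diag_cdfE joint_cdf_fin. Qed.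

Lemma diag_integral_bounds (d := fine (diag_cdf mu (1 / 2))) :
  [/\ 0 <= d, d <= 1 / 2,
   ((1 / 4 + d ^+ 2 / 2)%:E <= diag_integral mu)%E &
   (diag_integral mu <= (1 / 2 - (1 / 2 - d) ^+ 2)%:E)%E].
Proof.
have dE : diag_cdf mu (1 / 2) = d%:E by rewrite fineK// diag_cdf_fin.
have F0 t : (0 <= diag_cdf mu t)%E by exact: measure_ge0.
have mF := measurable_diag_cdf mu.
have d0 : 0 <= d by have := F0 (1 / 2); rewrite dE lee_fin.
have d1 : d <= 1 / 2.
  by have := @diag_cdf_le (1 / 2); rewrite dE lee_fin; apply; lra.
have Flo t : 0 <= t <= 1 / 2 -> ((2 * t + (d - 1))%:E <= diag_cdf mu t)%E.
  move=> t01; have := @diag_cdf_lipschitz t (1 / 2).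
  rewrite dE -(fineK (diag_cdf_fin t)) -EFinD !lee_fin => H.
  have : d <= fine (diag_cdf mu t) + 2 * (1 / 2 - t) by apply: H; lra.
  lra.
have Flo1 t : 0 <= t <= 1 -> ((2 * t + -1)%:E <= diag_cdf mu t)%E.
  move=> t01; have := @diag_cdf_lipschitz t 1.
  rewrite diag_cdf1 -(fineK (diag_cdf_fin t)) -EFinD !lee_fin => H.
  have : 1 <= fine (diag_cdf mu t) + 2 * (1 - t) by apply: H; lra.
  lra.
have Fhi t : 1 / 2 <= t <= 1 -> (diag_cdf mu t <= (2 * t + (d - 1))%:E)%E.
  move=> t01; have := @diag_cdf_lipschitz (1 / 2) t.
  rewrite dE -(fineK (diag_cdf_fin t)) -EFinD !lee_fin => H.
  have : fine (diag_cdf mu t) <= d + 2 * (t - 1 / 2) by apply: H; lra.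
  lra.
split => //.
(* The minorant of F is 0, then 2t + d - 1, then d, then 2t - 1. The breakpoints are the zero (1 -
   d)/2 of 2t + d - 1, the point 1/2 where it reaches d, and the point (1 + d)/2 where 2t - 1 =
   d. *)
- rewrite /diag_integral (integral_itv_split mF F0 (b := (1 - d) / 2)); [|lra..].
  rewrite [X in (_ <= _ + X)%E](integral_itv_split mF F0 (b := 1 / 2)); [|lra..].
  rewrite [X in (_ <= _ + (_ + X))%E](integral_itv_split mF F0 (b := (1 + d) / 2)); [|lra..].
  have -> : 1 / 4 + d ^+ 2 / 2 = 0 + (d ^+ 2 / 4 + (d ^+ 2 / 2 + (1 - d ^+ 2) / 4)).
    by lra.
  rewrite !EFinD; apply: leeD; first exact: integral_ge0.
  apply: leeD; last apply: leeD.
  + apply: (integral_ge_affine mF (p := 2) (q := d - 1)); [lra|nra|].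
    by move=> x x01; split; [lra|apply: Flo; lra].
  + apply: (integral_ge_affine mF (p := 0) (q := d)); [lra|nra|].
    move=> x x01; rewrite mul0r add0r; split => //.
    by rewrite -dE; apply: diag_cdf_homo; lra.
  + apply: (integral_ge_affine mF (p := 2) (q := -1)); [lra|nra|].
    by move=> x x01; split; [lra|apply: Flo1; lra].
(* The majorant of F is t, then d, then 2t + d - 1, then t again; the last two meet at 1 - d. *)
- rewrite /diag_integral (integral_itv_split mF F0 (b := d)); [|lra..].
  rewrite [X in (_ + X <= _)%E](integral_itv_split mF F0 (b := 1 / 2)); [|lra..].
  rewrite [X in (_ + (_ + X) <= _)%E](integral_itv_split mF F0 (b := 1 - d)); [|lra..].
  have -> : 1 / 2 - (1 / 2 - d) ^+ 2 =
      d ^+ 2 / 2 + (d * (1 / 2 - d) +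
        (((1 - d) ^+ 2 - 1 / 4 + (d - 1) * (1 / 2 - d)) + (1 - (1 - d) ^+ 2) / 2)).
    by lra.
  rewrite !EFinD; apply: leeD; last (apply: leeD; last apply: leeD).
  + apply: (integral_le_affine mF F0 (p := 1) (q := 0)); [lra|nra|].
    by move=> x x01; rewrite mul1r addr0; apply: diag_cdf_le; lra.
  + apply: (integral_le_affine mF F0 (p := 0) (q := d)); [lra|nra|].
    move=> x x01; rewrite mul0r add0r -dE; apply: diag_cdf_homo; lra.
  + apply: (integral_le_affine mF F0 (p := 2) (q := d - 1)); [lra|nra|].
    by move=> x x01; apply: Fhi; lra.
  + apply: (integral_le_affine mF F0 (p := 1) (q := 0)); [lra|nra|].
    by move=> x x01; rewrite mul1r addr0; apply: diag_cdf_le; lra.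
Qed.

End Inequalities.

(** * The region and its volume *)

(** The product measure is defined by slicing along the first factor. By uniqueness it equals the
    one sliced along the second factor, which allows fixing beta first and then phi. *)
Lemma product_measure1_ysection d1 d2 (T1 : measurableType d1)
    (T2 : measurableType d2) (R : realType)
    (m1 : {sigma_finite_measure set T1 -> \bar R})
    (m2 : {sigma_finite_measure set T2 -> \bar R}) (A : set (T1 * T2)) :
  measurable A -> (m1 \x m2)%E A = (\int[m2]_y m1 (ysection A y))%E.
Proof.
move=> mA.
transitivity ((m1 \x^ m2)%E A); last by [].
apply: product_measure_unique => // B C mB mC; exact: product_measure2E.
Qed.

Lemma sigma_finite_lebesgue2 (R : realType) :
  sigma_finite setT (@lebesgue_measure R \x @lebesgue_measure R)%E.
Proof.
pose I (n : nat) : set (measurableTypeR R) := `[- n%:R, n%:R]%classic.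
exists (fun n => I n `*` I n).
  apply/esym/seteqP; split => // -[x y] _.
  have N0 : 0 <= `|x| + `|y| by rewrite addr_ge0.
  exists (Num.truncn (`|x| + `|y|)).+1 => //.
  have /ltW := truncnS_gt (`|x| + `|y|).
  have := normr_ge0 x; have := normr_ge0 y; have := ler_norm x; have := ler_norm y.
  have := ler_norm (- x); have := ler_norm (- y); rewrite !normrN.
  by rewrite /I /= !in_itv /= => *; split; lra.
move=> n; split; first by apply: measurableX; exact: measurable_itv.
rewrite product_measure1E; [|exact: measurable_itv..].
have L : (lebesgue_measure (I n) < +oo)%E.
  by have := lebesgue_measure_itv `[- n%:R : R, n%:R]; rewrite /I /= => ->;
    case: ifP => _; rewrite -?EFinB ltry.
by rewrite lte_mul_pinfty// ge0_fin_numE.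
Qed.

(** A named planar measure carries the sigma-finite structure required to slice the threefold
    product along its last factor. *)
Definition lebesgue2 (R : realType) : set (measurableTypeR R * measurableTypeR R) -> \bar R :=
  (@lebesgue_measure R \x @lebesgue_measure R)%E.

HB.instance Definition _ (R : realType) := Measure.on (@lebesgue2 R).
HB.instance Definition _ (R : realType) :=
  Measure_isSigmaFinite.Build _ _ _ (@lebesgue2 R) (@sigma_finite_lebesgue2 R).

Section Region.
Variable R : realType.
Local Notation RR := (measurableTypeR R).
Local Notation lam := (@lebesgue_measure R).

(* The bounds on F(1/2) = (1 + beta)/4, int F = (phi + 2)/6 and E C(U, V) = (tau + 1)/4. *)
Definition tau_phi_beta_region : set (RR * RR * RR) :=
  [set z : R * R * R | [/\ -1 <= z.2 <= 1,
    3 * (1 + z.2) ^+ 2 / 16 - 1 / 2 <= z.1.2 <= 1 - 3 * (1 - z.2) ^+ 2 / 8 &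
    4 * z.1.2 - 1 <= 3 * z.1.1 <= 2 * z.1.2 + 1]].

Lemma copula_uniform_marginals (C : copula R) : uniform_marginals (copula_measure C).
Proof.
by split => u u01; rewrite copula_measureE ?lexx ?ler01// (copula_marginal1, copula_marginal2).
Qed.

Lemma copula_joint_cdf (C : copula R) (u v : R) : 0 <= u <= 1 -> 0 <= v <= 1 ->
  joint_cdf (copula_measure C) (u, v) = (C u v)%:E.
Proof.
move=> u01 v01; rewrite joint_cdfE ?copula_measureE//.
exact: copula_uniform_marginals.
Qed.

Lemma kendall_tauE (C : copula R) :
  kendall_tau C = 4 * fine (joint_integral (copula_measure C)) - 1.
Proof.
congr (4 * fine _ - 1); apply: eq_integral => -[u v].
by rewrite inE => /unit_squareP[u01 v01]; rewrite copula_joint_cdf.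
Qed.

Lemma spearman_footruleE (C : copula R) :
  spearman_footrule C = 6 * fine (diag_integral (copula_measure C)) - 2.
Proof.
congr (6 * fine _ - 2); apply: eq_integral => u.
by rewrite inE /= in_itv /= => u01; rewrite diag_cdfE copula_joint_cdf.
Qed.

Lemma blomqvist_betaE (C : copula R) :
  blomqvist_beta C = 4 * fine (diag_cdf (copula_measure C) (1 / 2)) - 1.
Proof. by rewrite diag_cdfE copula_joint_cdf//; lra. Qed.

Lemma Omega_subset_region : Omega R `<=` tau_phi_beta_region.
Proof.
move=> _ [C _ <-]; rewrite /tau_phi_beta_region /=.
rewrite kendall_tauE spearman_footruleE blomqvist_betaE.
have unif := copula_uniform_marginals C.
set mu := copula_measure C in unif *.
have [] := diag_integral_bounds unif.
have := joint_integral_ge unif.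
have := joint_integral_le unif.
rewrite -(fineK (diag_integral_fin unif)) -(fineK (joint_integral_fin unif)).
move: (fine (diag_integral mu)) (fine (joint_integral mu)) (fine (diag_cdf _ _)).
move=> S K d; rewrite -!EFinD !lee_fin => KS SK d0 d1 lo hi /=; split; apply/andP; split; lra.
Qed.

Lemma measurable_region : measurable tau_phi_beta_region.
Proof.
have m11 : measurable_fun setT (fun z : RR * RR * RR => z.1.1 : R).
  by apply: measurableT_comp.
have m12 : measurable_fun setT (fun z : RR * RR * RR => z.1.2 : R).
  by apply: measurableT_comp.
have m2 : measurable_fun setT (fun z : RR * RR * RR => z.2 : R).
  exact: measurable_snd.
have M (f g : RR * RR * RR -> R) : measurable_fun setT f -> measurable_fun setT g ->
    measurable [set z | f z <= g z].
  by move=> mf mg; rewrite -[X in measurable X]setTI; exact: measurable_fun_le.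
rewrite (_ : tau_phi_beta_region =
  ([set z : RR * RR * RR | -1 <= (z.2 : R)] `&` [set z : RR * RR * RR | (z.2 : R) <= 1]) `&`
  ([set z : RR * RR * RR | 3 * (1 + z.2) ^+ 2 / 16 - 1 / 2 <= (z.1.2 : R)] `&`
   [set z : RR * RR * RR | (z.1.2 : R) <= 1 - 3 * (1 - z.2) ^+ 2 / 8]) `&`
  ([set z : RR * RR * RR | 4 * z.1.2 - 1 <= 3 * (z.1.1 : R)] `&`
   [set z : RR * RR * RR | 3 * (z.1.1 : R) <= 2 * z.1.2 + 1])).
  apply: measurableI; first apply: measurableI; apply: measurableI; apply: M => //.
  - apply: measurable_funB => //; do 2 apply: measurable_funM => //.
    by apply: measurable_funX; exact: measurable_funD.
  - apply: measurable_funB => //; do 2 apply: measurable_funM => //.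
    by apply: measurable_funX; exact: measurable_funB.
  - by apply: measurable_funB => //; apply: measurable_funM.
  - by apply: measurable_funM.
  - by apply: measurable_funM.
  - by apply: measurable_funD => //; apply: measurable_funM.
apply/seteqP; split => -[[x y] z] /=.
  by move=> [/andP[? ?] /andP[? ?] /andP[? ?]].
by move=> [[[? ?] [? ?]] [? ?]]; split; apply/andP.
Qed.

(** [phi_lo] and [phi_hi] are the bounds 1/4 + d^2/2 and 1/2 - (1/2 - d)^2 on the integral of F,
    transported by phi = 6 S - 2 and d = (1 + b)/4. *)
Definition phi_lo (b : R) : R := 3 * (1 + b) ^+ 2 / 16 - 1 / 2.
Definition phi_hi (b : R) : R := 1 - 3 * (1 - b) ^+ 2 / 8.

Lemma ysection2E (A : set (RR * RR * RR)) (b phi : R) :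
  ysection (ysection A b) phi = [set t | A (t, phi, b)].
Proof.
apply/seteqP; split => t; first by move=> /set_mem/set_mem.
by move=> At; apply/mem_set/mem_set.
Qed.

Lemma region_tau_section (b phi : R) : -1 <= b <= 1 ->
  lam (ysection (ysection tau_phi_beta_region b) phi) =
  ((fun x : R => (- 2 / 3 * x + 2 / 3)%:E) \_ `[phi_lo b, phi_hi b]%classic) phi.
Proof.
move=> b01; rewrite patchE; case: ifPn => [|out].
- rewrite inE /= in_itv /= => H.
  have -> : ysection (ysection tau_phi_beta_region b) phi =
      `[(4 * phi - 1) / 3, (2 * phi + 1) / 3]%classic.
    rewrite ysection2E; apply/seteqP; split => t; rewrite /= in_itv /=.
      by move=> [_ _ /= t01]; lra.
    by move=> t01; split => //=; lra.
  rewrite lebesgue_measure_itv /= lte_fin; move: H; rewrite /phi_lo /phi_hi => H.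
  case: ifPn => [_|]; first by rewrite -EFinB; congr (_%:E); lra.
  (* A degenerate interval means phi >= 1, while [phi_hi] is at most 1; hence phi = 1 and the affine
     length vanishes as well. *)
  by rewrite -leNgt => ?; congr (_%:E); nra.
- have -> : ysection (ysection tau_phi_beta_region b) phi = set0; last exact: measure0.
  rewrite ysection2E; apply/seteqP; split => // t [_ H _].
  by move: out; rewrite notin_setE /= in_itv.
Qed.

(* The polynomial is a primitive, in b, of the integral of 2(1 - x)/3 over [phi_lo b, phi_hi b]. *)
Lemma region_section_area (b : R) : -1 <= b <= 1 ->
  lebesgue2 (ysection tau_phi_beta_region b) =
  ((135 / 256 *: 'X - 9 / 128 *: 'X^2 - 17 / 128 *: 'X^3 + 15 / 256 *: 'X^4
    - 9 / 1280 *: 'X^5 : {poly R})^`().[b])%:E.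
Proof.
move=> b01.
have mB : measurable (ysection tau_phi_beta_region b).
  exact: measurable_ysection measurable_region.
transitivity (\int[lam]_phi lam (ysection (ysection tau_phi_beta_region b) phi))%E.
  exact: product_measure1_ysection.
transitivity (\int[lam]_(x in `[phi_lo b, phi_hi b]) (- 2 / 3 * x + 2 / 3)%:E)%E.
  rewrite [RHS]integral_mkcond; apply: eq_integral => phi _.
  exact: region_tau_section.
rewrite integral_affine; last by rewrite /phi_lo /phi_hi; nra.
congr (_%:E); rewrite /phi_lo /phi_hi.
rewrite !(derivD, derivN, derivZ, derivXn, derivX).
rewrite !(hornerD, hornerN, hornerZ, hornerXn, hornerX, hornerMn, hornerC).
by change (2.-1) with 1%N; change (3.-1) with 2%N; change (4.-1) with 3%N;
  change (5.-1) with 4%N; field.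
Qed.

Lemma volume_region : volume tau_phi_beta_region = (31 / 40)%:E.
Proof.
have mA := measurable_region.
transitivity (\int[lam]_b (@lebesgue2 R) (ysection tau_phi_beta_region b))%E.
  exact: (@product_measure1_ysection _ _ _ _ R (@lebesgue2 R) lam _ mA).
transitivity (\int[lam]_(b in `[(-1)%R, 1%R]) ((135 / 256 *: 'X - 9 / 128 *: 'X^2
    - 17 / 128 *: 'X^3 + 15 / 256 *: 'X^4 - 9 / 1280 *: 'X^5 : {poly R})^`().[b])%:E)%E.
  rewrite [RHS]integral_mkcond; apply: eq_integral => b _.
  rewrite patchE; case: ifPn => [|out].
    by rewrite inE /= in_itv /= => b01; exact: region_section_area.
  have -> : ysection tau_phi_beta_region b = set0; last exact: measure0.
  apply/seteqP; split => // t; rewrite /ysection /= inE /= => -[H _ _].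
  by move: out; rewrite notin_setE /= in_itv.
rewrite integral_deriv_poly; last by lra.
(* Even powers cancel between 1 and -1, leaving 2 (135/256 - 17/128 - 9/1280) = 31/40. *)
rewrite !(hornerD, hornerN, hornerZ, hornerXn, hornerX).
by congr (_%:E); field.
Qed.
End Region.

(** * Mixtures *)

Section Mixture.
Context d (T : measurableType d) (R : realType).
Variables (P Q : probability T R) (p : R) (p0 : 0 <= p) (q0 : 0 <= 1 - p).

Definition mixture : set T -> \bar R :=
  measure_add (mscale (NngNum p0) P) (mscale (NngNum q0) Q).

HB.instance Definition _ := Measure.on mixture.

Lemma mixtureE A : mixture A = (p%:E * P A + (1 - p)%:E * Q A)%E.
Proof. by rewrite /mixture measure_addE. Qed.

Let mixture_setT : mixture setT = 1%E.
Proof.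
by rewrite mixtureE !probability_setT !mule1 -EFinD; congr (_%:E); lra.
Qed.

HB.instance Definition _ := Measure_isProbability.Build _ _ _ mixture mixture_setT.

Lemma ge0_integral_mixture (D : set T) (f : T -> \bar R) : measurable D ->
  measurable_fun D f -> (forall x, D x -> 0 <= f x)%E ->
  (\int[mixture]_(x in D) f x =
   p%:E * \int[P]_(x in D) f x + (1 - p)%:E * \int[Q]_(x in D) f x)%E.
Proof.
move=> mD mf f0.
transitivity (\int[mscale (NngNum p0) P]_(x in D) f x +
   \int[mscale (NngNum q0) Q]_(x in D) f x)%E.
  exact: ge0_integral_measure_add.
by rewrite !ge0_integral_mscale.
Qed.

End Mixture.

(** * Copulas built from measures with uniform marginals, and intermediate values *)

Section CopulaOfMeasure.
Variable R : realType.
Local Notation RR := (measurableTypeR R).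
Local Notation Sq := (@unit_square R).

Section Build.
Variable mu : probability (RR * RR)%type R.
Hypothesis unif : uniform_marginals mu.

(** Left transparent, so that its [copula_measure] computes to [mu]. *)
Definition copula_of_measure : copula R.
Proof.
refine (@Copula R (fun u v => fine (mu (`[0, u] `*` `[0, v]))) mu _ _ _).
- move=> u v _ _; rewrite fineK// fin_num_measure//.
  by apply: measurableX; exact: measurable_itv.
- by move=> u u01; rewrite unif.1.
- by move=> u u01; rewrite unif.2.
Defined.

Lemma Omega_of_measure :
  Omega R (4 * fine (joint_integral mu) - 1, 6 * fine (diag_integral mu) - 2,
           4 * fine (diag_cdf mu (1 / 2)) - 1).
Proof.
exists copula_of_measure => //.
by rewrite kendall_tauE spearman_footruleE blomqvist_betaE.
Qed.

End Build.

Lemma integral_joint_cdf_fin (P Q : probability (RR * RR)%type R) :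
  (\int[P]_(z in Sq) joint_cdf Q z)%E \is a fin_num.
Proof.
rewrite ge0_fin_numE; last exact: integral_ge0.
apply: (@le_lt_trans _ _ (\int[P]_(z in Sq) cst 1 z)%E).
  apply: ge0_le_integral => //.
  - exact: measurable_unit_square.
  - by apply: measurable_funTS; exact: measurable_joint_cdf.
  - by move=> z _; exact: joint_cdf_le1.
rewrite integral_cst ?mul1e; last exact: measurable_unit_square.
apply: (@le_lt_trans _ _ 1%E); last exact: ltry.
by apply: probability_le1; exact: measurable_unit_square.
Qed.

Lemma uniform_marginals_mixture (P Q : probability (RR * RR)%type R) (p : R)
    (p0 : 0 <= p) (q0 : 0 <= 1 - p) :
  uniform_marginals P -> uniform_marginals Q ->
  uniform_marginals (mixture P Q p0 q0).
Proof.
move=> [P1 P2] [Q1 Q2]; split => u u01; apply: (etrans (mixtureE _ _ _ _ _)).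
  by rewrite P1// Q1// -!EFinM -EFinD; congr (_%:E); lra.
by rewrite P2// Q2// -!EFinM -EFinD; congr (_%:E); lra.
Qed.

(* Along the segment from Q to P the diagonal stays fixed, while the integral
   of C dC is a quadratic polynomial in the weight. *)
Lemma exists_intermediate (P Q : probability (RR * RR)%type R) (S d k : R) :
  uniform_marginals P -> uniform_marginals Q ->
  diag_integral P = S%:E -> diag_integral Q = S%:E ->
  diag_cdf P (1 / 2) = d%:E -> diag_cdf Q (1 / 2) = d%:E ->
  (joint_integral P <= k%:E <= joint_integral Q)%E ->
  exists2 mu : probability (RR * RR)%type R, uniform_marginals mu &
    [/\ diag_integral mu = S%:E, diag_cdf mu (1 / 2) = d%:E & joint_integral mu = k%:E].
Proof.
move=> uP uQ SP SQ dP dQ.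
have fK := integral_joint_cdf_fin.
(* The bilinear form behind the quadratic: both cross terms [K P Q] and [K Q P] are kept, so no
   symmetry of [K] has to be proved. *)
pose K (P Q : probability (RR * RR)%type R) := fine (\int[P]_(z in Sq) joint_cdf Q z)%E.
have KE (P' Q' : probability (RR * RR)%type R) :
    (\int[P']_(z in Sq) joint_cdf Q' z)%E = (K P' Q')%:E by rewrite fineK.
rewrite /joint_integral !KE !lee_fin => /andP[Pk kQ].
(* The value at p is k minus the integral of C dC for the mixture of weight p. It is k - K Q Q <= 0
   at 0 and k - K P P >= 0 at 1, so there is a root in between. *)
pose f : {poly R} := - (K P P - (K P Q + K Q P) + K Q Q) *: 'X^2
  + (2 * K Q Q - (K P Q + K Q P)) *: 'X + (k - K Q Q)%:P.
have fE p : f.[p] = k - (p ^+ 2 * K P P + p * (1 - p) * (K P Q + K Q P)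
    + (1 - p) ^+ 2 * K Q Q).
  by rewrite /f !(hornerD, hornerN, hornerZ, hornerXn, hornerX, hornerC); ring.
have [|p] := @poly_ivt _ f 0 1 ler01.
  by rewrite !fE; apply/andP; split; lra.
move=> /andP[p0 p1] /rootP; rewrite fE => fp.
have q0 : 0 <= 1 - p by lra.
have mS := @measurable_unit_square R.
exists (mixture P Q p0 q0); first exact: uniform_marginals_mixture.
have EE (x y : R) : (p%:E * x%:E + (1 - p)%:E * y%:E)%E = (p * x + (1 - p) * y)%:E.
  by rewrite -!EFinM -EFinD.
split.
- have DE : diag_cdf (mixture P Q p0 q0) =
      (fun t : R => p%:E * diag_cdf P t + (1 - p)%:E * diag_cdf Q t)%E.
    by apply/funext => t; exact: mixtureE.
  rewrite /diag_integral DE.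
  have mF (P' : probability (RR * RR)%type R) :
      measurable_fun (`[0, 1]%classic : set RR) (diag_cdf P').
    by apply: measurable_funTS; exact: measurable_diag_cdf.
  rewrite ge0_integralD//; first last.
  + by apply: measurable_funeM.
  + by move=> t _; rewrite mule_ge0// lee_fin.
  + by apply: measurable_funeM.
  + by move=> t _; rewrite mule_ge0// lee_fin.
  rewrite !ge0_integralZl// -/(diag_integral P) -/(diag_integral Q) SP SQ EE.
  congr (_%:E); lra.
- rewrite -[LHS]/(mixture P Q p0 q0 _) mixtureE.
  rewrite [X in (_ * X + _)%E]dP [X in (_ + _ * X)%E]dQ EE; congr (_%:E); lra.
- have mJ (P' : probability (RR * RR)%type R) : measurable_fun Sq (joint_cdf P').
    by apply: measurable_funTS; exact: measurable_joint_cdf.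
  have J (m : probability (RR * RR)%type R) :
      (\int[m]_(z in Sq) joint_cdf (mixture P Q p0 q0) z =
       (p * K m P + (1 - p) * K m Q)%:E)%E.
    have JE : joint_cdf (mixture P Q p0 q0) =
        (fun z => p%:E * joint_cdf P z + (1 - p)%:E * joint_cdf Q z)%E.
      by apply/funext => z; exact: mixtureE.
    rewrite JE.
    rewrite ge0_integralD//; first last.
    + by apply: measurable_funeM.
    + by move=> t _; rewrite mule_ge0// lee_fin.
    + by apply: measurable_funeM.
    + by move=> t _; rewrite mule_ge0// lee_fin.
    by rewrite !ge0_integralZl// !KE EE.
  rewrite ge0_integral_mixture//.
  rewrite !J EE; congr (_%:E); lra.
Qed.

End CopulaOfMeasure.

(** * Shuffles *)

Section Shuffle.
Variable R : realType.
Local Notation RR := (measurableTypeR R).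
Local Notation lam := (@lebesgue_measure R).
Local Notation Sq := (@unit_square R).

(* The graph of the monotone bijection of slope 1 (or -1 when [dec] is set)
   between two intervals of equal length. *)
Record piece := Piece { px0 : R; px1 : R; py0 : R; py1 : R; dec : bool }.
Implicit Types (c : piece) (s : seq piece).

(** Dropping the endpoints costs no mass and gives strict inequalities for the coordinates of the
    points of a piece. *)
Definition piece_dom c : set RR := `]0, px1 c - px0 c[%classic.

Definition piece_pos c (t : RR) : RR * RR :=
  (px0 c + t, if dec c then py1 c - t else py0 c + t).

Lemma measurable_piece_dom c : measurable (piece_dom c).
Proof. exact: measurable_itv. Qed.

Lemma measurable_piece_pos c : measurable_fun setT (piece_pos c).
Proof.
apply: measurable_fun_pair; first exact: measurable_funD.
by case: (dec c); [exact: measurable_funB|exact: measurable_funD].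
Qed.

Definition piece_measure c : set (RR * RR) -> \bar R :=
  pushforward (mrestr lam (measurable_piece_dom c)) (piece_pos c).

(** The measure axioms are borrowed from the pushforward structure, which depends on the
    measurability of [piece_pos c]. *)
Let pushed c : {measure set (RR * RR) -> \bar R} :=
  measure_function_pushforward__canonical__measure_function_Measure
    (mrestr lam (measurable_piece_dom c)) (measurable_piece_pos c).

HB.instance Definition _ c := isMeasure.Build _ _ _ (piece_measure c)
  (measure0 (pushed c)) (measure_ge0 (pushed c))
  (@measure_semi_sigma_additive _ _ _ (pushed c)).

Lemma piece_measureE c A : piece_measure c A = lam (piece_pos c @^-1` A `&` piece_dom c).
Proof. by []. Qed.

(** On a concrete list this computes to a finite conjunction, each component of which can be given
    to linear arithmetic. *)
Definition all_pieces (P : piece -> Prop) s := foldr (fun c => and (P c)) True s.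

Lemma all_pieces_impl (P Q : piece -> Prop) s :
  (forall c, P c -> Q c) -> all_pieces P s -> all_pieces Q s.
Proof. by move=> PQ; elim: s => //= c s IH [/PQ ? /IH ?]. Qed.

Lemma all_pieces_conj (P Q : piece -> Prop) s :
  all_pieces P s -> all_pieces Q s -> all_pieces (fun c => P c /\ Q c) s.
Proof. by elim: s => //= c s IH [? /IH H] [? /H ?]. Qed.

Fixpoint piece_values (f : piece -> \bar R) s (rs : seq R) : Prop :=
  match s, rs with
  | [::], [::] => True
  | c :: s', r :: rs' => f c = r%:E /\ piece_values f s' rs'
  | _, _ => False
  end.

Lemma sum_piece_values f s rs : piece_values f s rs ->
  (\sum_(c <- s) f c = (\sum_(r <- rs) r)%:E)%E.
Proof.
elim: s rs => [|c s IH] [|r rs] //=; first by rewrite !big_nil.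
by move=> [fc /IH E]; rewrite !big_cons fc E.
Qed.

Definition shuffle s : set (RR * RR) -> \bar R :=
  msum (fun k => piece_measure (nth (Piece 0 0 0 0 false) s k)) (size s).

HB.instance Definition _ s := Measure.on (shuffle s).

Lemma shuffleE s A : shuffle s A = (\sum_(c <- s) piece_measure c A)%E.
Proof. by rewrite (big_nth (Piece 0 0 0 0 false)) big_mkord. Qed.

Lemma shuffle_sum s A (r : piece -> R) :
  all_pieces (fun c => piece_measure c A = (r c)%:E) s ->
  shuffle s A = (\sum_(c <- s) r c)%:E.
Proof.
rewrite shuffleE -sumEFin; elim: s => [_|c s IH [Pc /IH Ps]]; first by rewrite !big_nil.
by rewrite !big_cons Pc Ps.
Qed.

Definition wf_piece c :=
  [/\ 0 <= px0 c, px0 c <= px1 c <= 1, 0 <= py0 c, py1 c <= 1 &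
      px1 c - px0 c = py1 c - py0 c].

Lemma lebesgue_oo (a b : R) : a <= b -> lam `]a, b[%classic = (b - a)%:E.
Proof.
move=> ab; rewrite lebesgue_measure_itv /= lte_fin; case: ltP => [_|ba].
  by rewrite EFinB.
by congr (_%:E); lra.
Qed.

Lemma lebesgue_oc (a b : R) : a <= b -> lam `]a, b]%classic = (b - a)%:E.
Proof.
move=> ab; rewrite lebesgue_measure_itv /= lte_fin; case: ltP => [_|ba].
  by rewrite EFinB.
by congr (_%:E); lra.
Qed.

Lemma lebesgue_co (a b : R) : a <= b -> lam `[a, b[%classic = (b - a)%:E.
Proof.
move=> ab; rewrite lebesgue_measure_itv /= lte_fin; case: ltP => [_|ba].
  by rewrite EFinB.
by congr (_%:E); lra.
Qed.

Lemma piece_posP c (t : R) : wf_piece c -> piece_dom c t ->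
  [/\ px0 c < (piece_pos c t).1, (piece_pos c t).1 < px1 c,
      py0 c < (piece_pos c t).2 & (piece_pos c t).2 < py1 c].
Proof.
move=> [_ _ _ _ e]; rewrite /piece_dom /piece_pos /= in_itv /= => /andP[t0 t1].
by case: (dec c); split; lra.
Qed.

Lemma piece_pos_unit_square c (t : R) : wf_piece c -> piece_dom c t -> Sq (piece_pos c t).
Proof.
move=> w /(piece_posP w)[]; case: w; case: (piece_pos c t) => u v /= *.
by split; rewrite /= in_itv /=; lra.
Qed.

Lemma piece_measure_full c A : wf_piece c ->
  (forall t, piece_dom c t -> A (piece_pos c t)) -> piece_measure c A = (px1 c - px0 c)%:E.
Proof.
move=> [_ ? _ _ _] H; rewrite piece_measureE setIidr; last exact: H.
by rewrite lebesgue_oo ?subr0//; lra.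
Qed.

(** The exceptional parameter t is there for the comparison of a support point with its own piece: a
    single parameter has Lebesgue measure zero. *)
Lemma piece_measure_null c A (t : R) :
  (forall t', piece_dom c t' -> A (piece_pos c t') -> t' = t) ->
  measurable A -> piece_measure c A = 0%E.
Proof.
move=> H mA; rewrite piece_measureE.
apply: (@subset_measure0 _ _ _ lam _ [set t]) => //.
- apply: measurableI; last exact: measurable_piece_dom.
  by rewrite -[X in measurable X]setTI; exact: measurable_piece_pos.
- by move=> t' [At' /H]; exact.
- exact: lebesgue_measure_set1.
Qed.

(** The right-hand side is the length of the part of [px0 c, px1 c] to the left of u, written as a
    difference of minima so that the sum over the pieces telescopes. *)
Lemma piece_marginal1 c (u : R) : wf_piece c -> 0 <= u <= 1 ->
  piece_measure c (`[0, u] `*` `[0, 1]) = (Num.min u (px1 c) - Num.min u (px0 c))%:E.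
Proof.
move=> w u01; have [? ? ? ? e] := w; rewrite piece_measureE.
have -> : piece_pos c @^-1` (`[0, u] `*` `[0, 1]) `&` piece_dom c =
    piece_dom c `&` [set t | px0 c + t <= u].
  apply/seteqP; split => t.
    by move=> [[/=]]; rewrite !in_itv /= => /andP[_ ->].
  move=> [dt /= tu]; split=> //; have [] := piece_pos_unit_square w dt.
  by rewrite /= !in_itv /= => /andP[-> _] ->; rewrite tu.
have [ux0|x0u] := leP u (px0 c).
  rewrite min_l; last lra.
  rewrite subrr (_ : _ `&` _ = set0) ?measure0//.
  by apply/seteqP; split => // t []; rewrite /piece_dom /= in_itv /=; lra.
have [ux1|x1u] := ltP u (px1 c).
  transitivity (lam `]0, u - px0 c]%classic); last by rewrite lebesgue_oc ?subr0//; lra.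
  congr (lam _); apply/seteqP; split => t; rewrite /piece_dom /= !in_itv /=.
    by move=> [? ?]; lra.
  by move=> ?; split; lra.
transitivity (lam (piece_dom c)); last by rewrite lebesgue_oo ?subr0//; lra.
congr (lam _); apply/seteqP; split => t; rewrite /piece_dom /= !in_itv /=.
  by move=> [? ?]; lra.
by move=> ?; split; lra.
Qed.

Lemma piece_marginal2 c (v : R) : wf_piece c -> 0 <= v <= 1 ->
  piece_measure c (`[0, 1] `*` `[0, v]) = (Num.min v (py1 c) - Num.min v (py0 c))%:E.
Proof.
move=> w v01; have [? ? ? ? e] := w; rewrite piece_measureE.
have -> : piece_pos c @^-1` (`[0, 1] `*` `[0, v]) `&` piece_dom c =
    piece_dom c `&` [set t | (piece_pos c t).2 <= v].
  apply/seteqP; split => t.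
    by move=> [[/=]]; rewrite !in_itv /= => _ /andP[_ ->].
  move=> [dt /= tv]; split=> //; have [] := piece_pos_unit_square w dt.
  by rewrite /= !in_itv /= => -> /andP[-> _]; rewrite tv.
have [vy0|y0v] := leP v (py0 c).
  rewrite min_l; last lra.
  rewrite subrr (_ : _ `&` _ = set0) ?measure0//.
  apply/seteqP; split => // t [/(piece_posP w)[_ _ H _] H'].
  by have := lt_le_trans H (le_trans H' vy0); rewrite ltxx.
have [vy1|y1v] := ltP v (py1 c).
  (* On a decreasing piece the height is at most v from the parameter py1 c - v onwards; on an
     increasing one, up to v - py0 c. *)
  case E : (dec c).
    transitivity (lam `[py1 c - v, px1 c - px0 c[%classic); last first.
      by rewrite lebesgue_co; [congr (_%:E); lra|lra].
    congr (lam _); apply/seteqP; split => t; rewrite /piece_dom /= E !in_itv /=.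
      by move=> [? ?]; lra.
    by move=> ?; split; lra.
  transitivity (lam `]0, v - py0 c]%classic); last by rewrite lebesgue_oc ?subr0//; lra.
  congr (lam _); apply/seteqP; split => t; rewrite /piece_dom /= E !in_itv /=.
    by move=> [? ?]; lra.
  by move=> ?; split; lra.
rewrite -e; transitivity (lam (piece_dom c)); last by rewrite lebesgue_oo ?subr0//; lra.
congr (lam _); apply/seteqP; split => t; first by move=> [].
by move=> dt; split => //; have [_ _ _ /ltW/le_trans] := piece_posP w dt; exact.
Qed.

Lemma piece_measure_max_full c (t : R) : wf_piece c -> px1 c <= t -> py1 c <= t ->
  piece_measure c (@coord_max R @^-1` `]-oo, t]) = (px1 c - px0 c)%:E.
Proof.
move=> w x1t y1t; apply: piece_measure_full => // t' /(piece_posP w)[].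
case: (piece_pos c t') => u v /= *.
by rewrite in_itv /= /coord_max ge_max; apply/andP; split => /=; lra.
Qed.

Lemma piece_measure_max0 c (t : R) : wf_piece c -> t <= px0 c \/ t <= py0 c ->
  piece_measure c (@coord_max R @^-1` `]-oo, t]) = 0%E.
Proof.
move=> w H; apply: (@piece_measure_null c _ 0).
  move=> t' /(piece_posP w)[]; case: (piece_pos c t') => u v /= ux0 _ vy0 _.
  by rewrite in_itv /= /coord_max ge_max => /andP[] /=; case: H => *; lra.
by apply: measurable_preimage_itv; exact: measurable_coord_max.
Qed.

Lemma integral_piece c (f : RR * RR -> \bar R) : wf_piece c ->
  measurable_fun Sq f -> (forall z, Sq z -> (0 <= f z)%E) ->
  (\int[piece_measure c]_(z in Sq) f z =
   \int[lam]_(t in piece_dom c) f (piece_pos c t))%E.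
Proof.
move=> w mf f0; have mS := @measurable_unit_square R.
have mD := measurable_piece_dom c; have mp := measurable_piece_pos c.
have mpS : measurable (piece_pos c @^-1` Sq).
  by rewrite -[X in measurable X]setTI; exact: mp.
rewrite ge0_integral_pushforward//; last by move=> z; rewrite inE; exact: f0.
have mfp : measurable_fun (piece_pos c @^-1` Sq) (f \o piece_pos c).
  apply: (measurable_comp mS) => //; first by move=> _ [t ? <-].
  exact: measurable_funTS.
rewrite (@ge0_negligible_integral _ _ _ _ _ (~` piece_dom c))//.
- rewrite setDE setCK (_ : _ `&` _ = piece_dom c); last first.
    by apply/setIidPr => t; exact: piece_pos_unit_square.
  apply: eq_measure_integral => A mA AD.
  by rewrite -[LHS]/(lam (A `&` piece_dom c)) setIidl.
- exact: measurableC.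
- by move=> t; exact: f0.
- by apply: etrans (measure0 lam); congr (lam _); exact: setICl.
Qed.

Lemma integral_shuffle s (f : RR * RR -> \bar R) : all_pieces wf_piece s ->
  measurable_fun Sq f -> (forall z, Sq z -> (0 <= f z)%E) ->
  (\int[shuffle s]_(z in Sq) f z =
   \sum_(c <- s) \int[lam]_(t in piece_dom c) f (piece_pos c t))%E.
Proof.
move=> ws mf f0; rewrite ge0_integral_measure_sum//; last exact: measurable_unit_square.
transitivity (\sum_(c <- s) \int[piece_measure c]_(z in Sq) f z)%E.
  by rewrite (big_nth (Piece 0 0 0 0 false)) big_mkord.
elim: s ws => [|c s IH] /=; first by rewrite !big_nil.
by move=> [wc ws]; rewrite !big_cons IH// integral_piece.
Qed.

Lemma eq_integral_shuffle s (f g : RR * RR -> \bar R) :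
  all_pieces wf_piece s ->
  measurable_fun Sq f -> (forall z, Sq z -> (0 <= f z)%E) ->
  measurable_fun Sq g -> (forall z, Sq z -> (0 <= g z)%E) ->
  all_pieces (fun c => forall t, piece_dom c t -> f (piece_pos c t) = g (piece_pos c t)) s ->
  (\int[shuffle s]_(z in Sq) f z = \int[shuffle s]_(z in Sq) g z)%E.
Proof.
move=> ws mf f0 mg g0 H; rewrite !integral_shuffle//.
elim: s H {ws} => [_|c s IH [Hc /IH Hs]]; first by rewrite !big_nil.
rewrite !big_cons Hs; congr (_ + _)%E.
by apply: eq_integral => t; rewrite inE => /Hc.
Qed.

Lemma integral_affine_oo (p q l : R) : 0 <= l ->
  (\int[lam]_(t in `]0%R, l[) (p * t + q)%:E = (l * (p * l / 2 + q))%:E)%E.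
Proof.
move=> l0; rewrite -(@integral_itv_bndoo R 0 l _ true false).
  by rewrite integral_affine//; congr (_%:E); lra.
apply/measurable_EFinP; apply: measurable_funTS; exact: measurable_funD.
Qed.

(** Above the diagonal the maximum is the ordinate, whose mean over the piece is (py0 c + py1 c)/2.
    An increasing piece stays on the side of its lower left corner, while for a decreasing one the
    whole box is required to lie above the diagonal. *)
Lemma integral_piece_above c : wf_piece c -> px0 c <= py0 c ->
  (dec c -> px1 c <= py0 c) ->
  (\int[lam]_(t in piece_dom c) (1 - coord_max (piece_pos c t))%:E =
   ((px1 c - px0 c) * (1 - (py0 c + py1 c) / 2))%:E)%E.
Proof.
move=> w xy dxy; have [? ? ? ? e] := w; case E : (dec c).
  transitivity (\int[lam]_(t in piece_dom c) (1 * t + (1 - py1 c))%:E)%E.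
    apply: eq_integral => t; rewrite inE /piece_dom /= in_itv /= => t01.
    congr (_%:E); rewrite /coord_max /piece_pos E max_r /=; first by lra.
    by have := dxy E; lra.
  by rewrite integral_affine_oo; [congr (_%:E); nra|lra].
transitivity (\int[lam]_(t in piece_dom c) (-1 * t + (1 - py0 c))%:E)%E.
  apply: eq_integral => t; rewrite inE /piece_dom /= in_itv /= => t01.
  by congr (_%:E); rewrite /coord_max /piece_pos E max_r /=; lra.
by rewrite integral_affine_oo; [congr (_%:E); nra|lra].
Qed.

Lemma integral_piece_below c : wf_piece c -> py0 c <= px0 c ->
  (dec c -> py1 c <= px0 c) ->
  (\int[lam]_(t in piece_dom c) (1 - coord_max (piece_pos c t))%:E =
   ((px1 c - px0 c) * (1 - (px0 c + px1 c) / 2))%:E)%E.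
Proof.
move=> w xy dxy; have [? ? ? ? e] := w.
transitivity (\int[lam]_(t in piece_dom c) (-1 * t + (1 - px0 c))%:E)%E.
  apply: eq_integral => t; rewrite inE /piece_dom /= in_itv /= => t01.
  congr (_%:E); rewrite /coord_max /piece_pos max_l /=; first by lra.
  by case E : (dec c); [have := dxy E; lra|lra].
by rewrite integral_affine_oo; [congr (_%:E); nra|lra].
Qed.

Section ShuffleProbability.
Variable s : seq piece.
Hypothesis ws : all_pieces wf_piece s.
Hypothesis px_cover : forall u : R, 0 <= u <= 1 ->
  \sum_(c <- s) (Num.min u (px1 c) - Num.min u (px0 c)) = u.
Hypothesis py_cover : forall v : R, 0 <= v <= 1 ->
  \sum_(c <- s) (Num.min v (py1 c) - Num.min v (py0 c)) = v.

Let shuffle_setT : shuffle s setT = 1%E.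
Proof.
rewrite (@shuffle_sum _ _ (fun c => px1 c - px0 c)).
  congr (_%:E); rewrite -[RHS](px_cover (u := 1)) ?lexx ?ler01//.
  elim: s ws => [|c s' IH] /=; first by rewrite !big_nil.
  move=> [[]] ? ? ? ? ? /IH; rewrite !big_cons => ->.
  by rewrite !min_r//; lra.
by apply: all_pieces_impl ws => c wc; apply: piece_measure_full.
Qed.

Definition shuffle_prob : probability (RR * RR)%type R :=
  HB.pack (shuffle s) (Measure_isProbability.Build _ _ _ (shuffle s) shuffle_setT).

Lemma shuffle_uniform : uniform_marginals shuffle_prob.
Proof.
split => u u01; rewrite -[LHS]/(shuffle s _).
- rewrite (@shuffle_sum _ _ (fun c => Num.min u (px1 c) - Num.min u (px0 c))).
    by rewrite px_cover.
  by apply: all_pieces_impl ws => c wc; exact: piece_marginal1.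
- rewrite (@shuffle_sum _ _ (fun c => Num.min u (py1 c) - Num.min u (py0 c))).
    by rewrite py_cover.
  by apply: all_pieces_impl ws => c wc; exact: piece_marginal2.
Qed.

Lemma shuffle_null (A : set (RR * RR)) (t : R) : measurable A ->
  all_pieces (fun c => forall t', piece_dom c t' -> A (piece_pos c t') -> t' = t) s ->
  shuffle_prob A = 0%E.
Proof.
move=> mA H; rewrite -[LHS]/(shuffle s _) (@shuffle_sum _ _ (fun=> 0)).
  by rewrite big1.
by apply: all_pieces_impl H => c Hc; exact: (piece_measure_null Hc).
Qed.

Lemma shuffle_diag_cdf (t : R) (rs : seq R) :
  piece_values (fun c => piece_measure c (@coord_max R @^-1` `]-oo, t])) s rs ->
  diag_cdf shuffle_prob t = (\sum_(r <- rs) r)%:E.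
Proof. by move/sum_piece_values <-; exact: shuffleE. Qed.

Lemma shuffle_diag_integral (rs : seq R) :
  piece_values (fun c =>
    \int[lam]_(t in piece_dom c) (1 - coord_max (piece_pos c t))%:E)%E s rs ->
  diag_integral shuffle_prob = (\sum_(r <- rs) r)%:E.
Proof.
move/sum_piece_values <-; rewrite (diag_integral_1sub_max shuffle_uniform).
apply: (integral_shuffle ws).
- apply/measurable_EFinP; apply: measurable_funTS; apply: measurable_funB => //.
  exact: measurable_coord_max.
- by move=> z /coord_max_01; rewrite lee_fin; lra.
Qed.

Lemma probability_eq_null (mu : probability (RR * RR)%type R) (A B : set (RR * RR)) :
  measurable A -> measurable B -> A `<=` B -> mu (B `\` A) = 0%E -> mu A = mu B.
Proof.
move=> mA mB AB N; rewrite [RHS](measureDI mu mB mA) setIidr//.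
by rewrite [X in (X + _)%E]N add0e.
Qed.

(* No point of the support lies up and to the left of a support point above the
   diagonal, nor down and to the right of one below it; [t' = t] leaves out
   the support point itself, which has measure zero. *)
Definition no_outward_pair (c c' : piece) (t t' : R) : Prop :=
  let z := piece_pos c t in let w := piece_pos c' t' in
  (z.1 <= z.2 -> w.1 <= z.1 -> z.2 < w.2 -> t' = t) /\
  (z.2 <= z.1 -> w.2 <= z.2 -> z.1 < w.1 -> t' = t).

(* With m = min(z.1, z.2), no support point lies in the quadrant below z but
   not in the quadrant below (m, m). *)
Definition no_inward_pair (c c' : piece) (t t' : R) : Prop :=
  let z := piece_pos c t in let w := piece_pos c' t' in
  (z.1 <= z.2 -> w.1 <= z.1 -> z.1 < w.2 -> w.2 <= z.2 -> t' = t) /\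
  (z.2 <= z.1 -> w.2 <= z.2 -> z.2 < w.1 -> w.1 <= z.1 -> t' = t).

Definition all_pairs (P : piece -> piece -> R -> R -> Prop) :=
  all_pieces (fun c => all_pieces (fun c' => forall t t' : R,
    0 < t < px1 c - px0 c -> 0 < t' < px1 c' - px0 c' -> P c c' t t') s) s.

(** Equality in C <= min at every support point: above the diagonal, C(z) = z.1 as soon as the strip
    x <= z.1 carries no mass higher than z.2, and symmetrically below it. *)
Lemma shuffle_joint_integral_max : all_pairs no_outward_pair ->
  joint_integral shuffle_prob = diag_integral shuffle_prob.
Proof.
move=> H; rewrite -(integral_min shuffle_uniform).
have unif := shuffle_uniform.
apply: (eq_integral_shuffle ws) => //.
- by apply: measurable_funTS; exact: measurable_joint_cdf.
- exact: measurable_EFin_Sq (@measurable_coord_min R).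
- by move=> z /coord_min_01; rewrite lee_fin => /andP[].
apply: all_pieces_impl (all_pieces_conj ws H) => c [wc Hc] t dt.
have zS := piece_pos_unit_square wc dt; set z := piece_pos c t in zS *.
have t01 : 0 < t < px1 c - px0 c by move: dt; rewrite /piece_dom /= in_itv.
have [z1 z2] := unit_squareP zS; rewrite /coord_min.
have [zz|/ltW zz] := leP z.1 z.2.
- rewrite -(mu_fst_le unif z1); apply: probability_eq_null.
  + exact: measurable_quadrant.
  + exact: measurable_preimage_itv measurable_fst.
  + by move=> x [].
  + apply: (@shuffle_null _ t).
      apply: measurableD; last exact: measurable_quadrant.
      exact: measurable_preimage_itv measurable_fst.
    apply: all_pieces_impl Hc => c' Hc' t'; rewrite /piece_dom /= in_itv /= => t'01.
    have [/(_ zz) + _] := Hc' t t' t01 t'01 => H1.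
    rewrite !in_itv => -[xz nyz]; apply: H1; first exact: xz.
    by rewrite ltNge; apply/negP => yz; apply: nyz.
- rewrite -(mu_snd_le unif z2); apply: probability_eq_null.
  + exact: measurable_quadrant.
  + exact: measurable_preimage_itv measurable_snd.
  + by move=> x [].
  + apply: (@shuffle_null _ t).
      apply: measurableD; last exact: measurable_quadrant.
      exact: measurable_preimage_itv measurable_snd.
    apply: all_pieces_impl Hc => c' Hc' t'; rewrite /piece_dom /= in_itv /= => t'01.
    have [_ /(_ zz) +] := Hc' t t' t01 t'01 => H1.
    rewrite !in_itv => -[yz nxz]; apply: H1; first exact: yz.
    by rewrite ltNge; apply/negP => xz; apply: nxz.
Qed.

(** Equality in C(z) >= F(min(z.1, z.2)) at every support point: the quadrant below z has no more
    mass than the smaller square quadrant inside it. *)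
Lemma shuffle_joint_integral_min : all_pairs no_inward_pair ->
  (joint_integral shuffle_prob + (1 / 2)%:E =
   diag_integral shuffle_prob + diag_integral shuffle_prob)%E.
Proof.
move=> H; rewrite -(integral_diag_cdf_min shuffle_uniform); congr (_ + _)%E.
apply: (eq_integral_shuffle ws) => //.
- by apply: measurable_funTS; exact: measurable_joint_cdf.
- apply: measurable_funTS; apply: measurableT_comp; first exact: measurable_diag_cdf.
  exact: measurable_coord_min.
apply: all_pieces_impl (all_pieces_conj ws H) => c [wc Hc] t dt.
have t01 : 0 < t < px1 c - px0 c by move: dt; rewrite /piece_dom /= in_itv.
rewrite diag_cdfE; apply/esym/probability_eq_null.
- exact: measurable_quadrant.
- exact: measurable_quadrant.
- rewrite /coord_min => -[x y] /=; rewrite !in_itv /= => -[].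
  by rewrite !le_min => /andP[? _] /andP[].
apply: (@shuffle_null _ t).
  by apply: measurableD; exact: measurable_quadrant.
apply: all_pieces_impl Hc => c' Hc' t' dt'.
have t'01 : 0 < t' < px1 c' - px0 c' by move: dt'; rewrite /piece_dom /= in_itv.
have := Hc' t t' t01 t'01; rewrite /no_inward_pair /coord_min.
case: (piece_pos c t) => u v; case: (piece_pos c' t') => x y /=.
rewrite !in_itv /=; case: (leP u v) => [uv|/ltW vu] [H1 H2] [[xu yv] nxy].
- by apply: H1 => //; rewrite ltNge; apply/negP => yu; apply: nxy.
- by apply: H2 => //; rewrite ltNge; apply/negP => xv; apply: nxy.
Qed.

End ShuffleProbability.

End Shuffle.

(** * The two extremal families *)

Section ExtremalShuffles.
Variable R : realType.
Variables a d : R.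
Hypothesis a0 : 0 <= a.
Hypothesis ad : a <= d.
Hypothesis d1 : d <= 1 / 2.

(** With e = (d - a)/2 the breakpoints are 0, a, a + e, 1/2 - e, 1/2, 1/2 + e, 1 - a - e, 1 - a, 1.
    The ends [0, a] and [1 - a, 1] carry the identity. Between them, three pieces rise above the
    diagonal and the other three are their mirror images. The square [0, 1/2]^2 receives a + 2e =
    d. *)
Definition max_tau_pieces : seq (piece R) :=
  [:: Piece 0 a 0 a false;
      Piece a ((a + d) / 2) ((1 + a - d) / 2) (1 / 2) false;
      Piece ((a + d) / 2) ((1 + a - d) / 2) ((1 + d - a) / 2) (1 - (a + d) / 2) false;
      Piece ((1 + a - d) / 2) (1 / 2) a ((a + d) / 2) false;
      Piece (1 / 2) ((1 + d - a) / 2) (1 - (a + d) / 2) (1 - a) false;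
      Piece ((1 + d - a) / 2) (1 - (a + d) / 2) ((a + d) / 2) ((1 + a - d) / 2) false;
      Piece (1 - (a + d) / 2) (1 - a) (1 / 2) ((1 + d - a) / 2) false;
      Piece (1 - a) 1 (1 - a) 1 false].

(** Identity on the two ends again. In the middle the support consists of the antidiagonals of the
    squares [1/2 - (d - a), 1/2]^2 and [1/2, 1/2 + (d - a)]^2, and of the outer parts of the line x
    + y = 1. The small antidiagonals are cut at their midpoints so that each piece stays on one side
    of the diagonal. *)
Definition min_tau_pieces : seq (piece R) :=
  [:: Piece 0 a 0 a false;
      Piece a (1 / 2 + a - d) (1 / 2 + d - a) (1 - a) true;
      Piece (1 / 2 + a - d) ((1 + a - d) / 2) ((1 + a - d) / 2) (1 / 2) true;
      Piece ((1 + a - d) / 2) (1 / 2) (1 / 2 + a - d) ((1 + a - d) / 2) true;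
      Piece (1 / 2) ((1 + d - a) / 2) ((1 + d - a) / 2) (1 / 2 + d - a) true;
      Piece ((1 + d - a) / 2) (1 / 2 + d - a) (1 / 2) ((1 + d - a) / 2) true;
      Piece (1 / 2 + d - a) (1 - a) a (1 / 2 + a - d) true;
      Piece (1 - a) 1 (1 - a) 1 false].

Local Ltac wf := move: a0 ad d1 => ? ? ?; rewrite /= /wf_piece /=; do !split; lra.
Local Ltac cover :=
  move: a0 ad d1 => ? ? ? u u01; rewrite !big_cons big_nil /=;
  have -> : Num.min u 1 = u; [by rewrite min_l; lra|];
  have -> : Num.min u 0 = 0; [by rewrite min_r; lra|ring].

Lemma max_tau_wf : all_pieces (@wf_piece R) max_tau_pieces.
Proof. wf. Qed.

Lemma min_tau_wf : all_pieces (@wf_piece R) min_tau_pieces.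
Proof. wf. Qed.

(** Each interior breakpoint is once a left end and once a right end, so all minima cancel except
    those with 1 and 0; the same happens in the three lemmas that follow. *)
Lemma max_tau_px_cover : forall u : R, 0 <= u <= 1 ->
  \sum_(c <- max_tau_pieces) (Num.min u (px1 c) - Num.min u (px0 c)) = u.
Proof. cover. Qed.

Lemma max_tau_py_cover : forall u : R, 0 <= u <= 1 ->
  \sum_(c <- max_tau_pieces) (Num.min u (py1 c) - Num.min u (py0 c)) = u.
Proof. cover. Qed.

Lemma min_tau_px_cover : forall u : R, 0 <= u <= 1 ->
  \sum_(c <- min_tau_pieces) (Num.min u (px1 c) - Num.min u (px0 c)) = u.
Proof. cover. Qed.

Lemma min_tau_py_cover : forall u : R, 0 <= u <= 1 ->
  \sum_(c <- min_tau_pieces) (Num.min u (py1 c) - Num.min u (py0 c)) = u.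
Proof. cover. Qed.

Local Ltac pairs P :=
  move: a0 ad d1 => ? ? ?; rewrite /all_pairs /P /=; do !split;
  rewrite /piece_pos /= => *; lra.

(** Positions are affine in the parameters, so each of the 64 pairs of pieces is a question of
    linear arithmetic. *)
Lemma max_tau_pairs : all_pairs max_tau_pieces (@no_outward_pair R).
Proof. pairs no_outward_pair. Qed.

Lemma min_tau_pairs : all_pairs min_tau_pieces (@no_inward_pair R).
Proof. pairs no_inward_pair. Qed.

End ExtremalShuffles.

Section ExtremalProbabilities.
Variable R : realType.
Local Notation RR := (measurableTypeR R).
Variables a d : R.
Hypothesis a0 : 0 <= a.
Hypothesis ad : a <= d.
Hypothesis d1 : d <= 1 / 2.

Definition max_tau_prob : probability (RR * RR)%type R :=
  shuffle_prob (max_tau_wf a0 ad d1) (max_tau_px_cover a0 ad d1).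

Definition min_tau_prob : probability (RR * RR)%type R :=
  shuffle_prob (min_tau_wf a0 ad d1) (min_tau_px_cover a0 ad d1).

Lemma max_tau_uniform : uniform_marginals max_tau_prob.
Proof. by apply: shuffle_uniform; exact: (max_tau_py_cover a0 ad d1). Qed.

Lemma min_tau_uniform : uniform_marginals min_tau_prob.
Proof. by apply: shuffle_uniform; exact: (min_tau_py_cover a0 ad d1). Qed.

Local Ltac wf_split w := move: w => /= [? [? [? [? [? [? [? [? _]]]]]]]].

Lemma max_tau_diag_half : diag_cdf max_tau_prob (1 / 2) = d%:E.
Proof.
move: a0 ad d1 => ? ? ?; wf_split (max_tau_wf a0 ad d1).
(* The list gives, piece by piece, the mass inside the square [0, 1/2]^2: every piece is either
   inside it or outside. *)
transitivity (\sum_(r <- [:: a - 0; (a + d) / 2 - a; 0; 1 / 2 - (1 + a - d) / 2; 0; 0; 0; 0])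
  r)%:E; last first.
  by congr (_%:E); rewrite !big_cons big_nil; lra.
apply: (shuffle_diag_cdf (max_tau_wf a0 ad d1) (max_tau_px_cover a0 ad d1));
  rewrite /=; do !split; try (by apply: piece_measure_max_full => //=; lra).
- by apply: piece_measure_max0 => //=; right; lra.
- by apply: piece_measure_max0 => //=; left; lra.
- by apply: piece_measure_max0 => //=; left; lra.
- by apply: piece_measure_max0 => //=; left; lra.
- by apply: piece_measure_max0 => //=; left; lra.
Qed.

Lemma min_tau_diag_half : diag_cdf min_tau_prob (1 / 2) = d%:E.
Proof.
move: a0 ad d1 => ? ? ?; wf_split (min_tau_wf a0 ad d1).
transitivity (\sum_(r <- [:: a - 0; 0;
  (1 + a - d) / 2 - (1 / 2 + a - d); 1 / 2 - (1 + a - d) / 2; 0; 0; 0; 0])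
  r)%:E; last first.
  by congr (_%:E); rewrite !big_cons big_nil; lra.
apply: (shuffle_diag_cdf (min_tau_wf a0 ad d1) (min_tau_px_cover a0 ad d1));
  rewrite /=; do !split; try (by apply: piece_measure_max_full => //=; lra).
- by apply: piece_measure_max0 => //=; right; lra.
- by apply: piece_measure_max0 => //=; left; lra.
- by apply: piece_measure_max0 => //=; left; lra.
- by apply: piece_measure_max0 => //=; left; lra.
- by apply: piece_measure_max0 => //=; left; lra.
Qed.

(** It grows from 1/4 + d^2/2 at a = 0 to 1/2 - (1/2 - d)^2 at a = d, so it sweeps exactly the range
    allowed by [diag_integral_bounds]. *)
Definition extremal_diag_integral : R := 1 / 4 + d ^+ 2 / 2 + a * (1 - d) - a ^+ 2 / 2.

Local Ltac above := by rewrite integral_piece_above //=; lra.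
Local Ltac below := by rewrite integral_piece_below //=; lra.

Lemma max_tau_diag_integral :
  diag_integral max_tau_prob = extremal_diag_integral%:E.
Proof.
move: a0 ad d1 => ? ? ?; wf_split (max_tau_wf a0 ad d1).
pose up (c : piece R) := (px1 c - px0 c) * (1 - (py0 c + py1 c) / 2).
pose down (c : piece R) := (px1 c - px0 c) * (1 - (px0 c + px1 c) / 2).
pose c i := nth (Piece 0 0 0 0 false) (max_tau_pieces a d) i.
transitivity (\sum_(r <- [:: up (c 0); up (c 1); up (c 2); down (c 3);
  up (c 4); down (c 5); down (c 6); up (c 7)]%N) r)%:E; last first.
  by congr (_%:E); rewrite !big_cons big_nil /up /down /c /= /extremal_diag_integral; field.
apply: (shuffle_diag_integral (max_tau_wf a0 ad d1) (max_tau_px_cover a0 ad d1)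
  (max_tau_py_cover a0 ad d1)).
rewrite /up /down /c; split; [above|]; split; [above|]; split; [above|]; split; [below|].
split; [above|]; split; [below|]; split; [below|]; split; [above|by []].
Qed.

Lemma min_tau_diag_integral :
  diag_integral min_tau_prob = extremal_diag_integral%:E.
Proof.
move: a0 ad d1 => ? ? ?; wf_split (min_tau_wf a0 ad d1).
pose up (c : piece R) := (px1 c - px0 c) * (1 - (py0 c + py1 c) / 2).
pose down (c : piece R) := (px1 c - px0 c) * (1 - (px0 c + px1 c) / 2).
pose c i := nth (Piece 0 0 0 0 false) (min_tau_pieces a d) i.
transitivity (\sum_(r <- [:: up (c 0); up (c 1); up (c 2); down (c 3);
  up (c 4); down (c 5); down (c 6); up (c 7)]%N) r)%:E; last first.
  by congr (_%:E); rewrite !big_cons big_nil /up /down /c /= /extremal_diag_integral; field.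
apply: (shuffle_diag_integral (min_tau_wf a0 ad d1) (min_tau_px_cover a0 ad d1)
  (min_tau_py_cover a0 ad d1)).
rewrite /up /down /c; split; [above|]; split; [above|]; split; [above|]; split; [below|].
split; [above|]; split; [below|]; split; [below|]; split; [above|by []].
Qed.

Lemma max_tau_joint_integral :
  joint_integral max_tau_prob = extremal_diag_integral%:E.
Proof.
rewrite -max_tau_diag_integral; apply: shuffle_joint_integral_max.
- exact: (max_tau_py_cover a0 ad d1).
- exact: (max_tau_pairs a0 ad d1).
Qed.

Lemma min_tau_joint_integral :
  joint_integral min_tau_prob = (2 * extremal_diag_integral - 1 / 2)%:E.
Proof.
have := shuffle_joint_integral_min (min_tau_wf a0 ad d1) (min_tau_px_cover a0 ad d1)
  (min_tau_py_cover a0 ad d1) (min_tau_pairs a0 ad d1).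
rewrite -[shuffle_prob _ _]/min_tau_prob min_tau_diag_integral.
by case: (joint_integral _) => // r [] e; congr (_%:E); lra.
Qed.

End ExtremalProbabilities.

(** * Every point of the region is attained *)

Section MainProof.
Variable R : realType.

Lemma region_subset_Omega : @tau_phi_beta_region R `<=` Omega R.
Proof.
move=> [[tau phi] beta] [/= b01 phi01 tau01].
pose d : R := (1 + beta) / 4.
pose S : R := (phi + 2) / 6.
pose k : R := (tau + 1) / 4.
pose disc := (1 - d) ^+ 2 - 2 * (S - 1 / 4 - d ^+ 2 / 2).
(* The smaller root of [extremal_diag_integral a d = S]. *)
pose a := (1 - d) - Num.sqrt disc.
have d0 : 0 <= d by rewrite /d; lra.
have d1 : d <= 1 / 2 by rewrite /d; lra.
have Slo : 1 / 4 + d ^+ 2 / 2 <= S by rewrite /S /d; lra.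
have Shi : S <= 1 / 2 - (1 / 2 - d) ^+ 2 by rewrite /S /d; lra.
(* This restates the upper bound on S and yields a <= d; the next inequality restates the lower
   bound and yields 0 <= a. *)
have disc_ge : (1 - 2 * d) ^+ 2 <= disc by rewrite /disc; lra.
have disc_le : disc <= (1 - d) ^+ 2 by rewrite /disc; lra.
have disc0 : 0 <= disc by apply: le_trans disc_ge; exact: sqr_ge0.
have sq := sqr_sqrtr disc0.
have sq_ge : 1 - 2 * d <= Num.sqrt disc.
  by rewrite -(ler_sqr (x := 1 - 2 * d)) ?nnegrE ?sqrtr_ge0 ?sq//; lra.
have sq_le : Num.sqrt disc <= 1 - d.
  by rewrite -(ler_sqr (y := 1 - d)) ?nnegrE ?sqrtr_ge0 ?sq//; lra.
have a0 : 0 <= a by rewrite /a; lra.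
have ad : a <= d by rewrite /a; lra.
have SE : extremal_diag_integral a d = S.
  move: sq; rewrite /extremal_diag_integral /a; move: (Num.sqrt disc) => x.
  by rewrite /disc => sq; nra.
have := @exists_intermediate _ (min_tau_prob a0 ad d1) (max_tau_prob a0 ad d1)
  S d k (min_tau_uniform a0 ad d1) (max_tau_uniform a0 ad d1).
rewrite min_tau_diag_integral max_tau_diag_integral SE min_tau_diag_half
  max_tau_diag_half min_tau_joint_integral max_tau_joint_integral SE.
case=> //.
  (* The two constraints on tau say exactly 2 S - 1/2 <= k <= S, the values reached by the two
     extremal shuffles. *)
  by rewrite !lee_fin /k /S; apply/andP; split; lra.
move=> mu unif [muS mud muk]; have := Omega_of_measure unif.
rewrite muS mud muk /=; congr (Omega R (_, _, _)); rewrite /k /S /d; lra.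
Qed.

End MainProof.

Theorem mainTheorem4 (R : realType) :
  measurable (Omega R) /\ volume (Omega R) = (31 / 40)%:E.
Proof.
have -> : Omega R = @tau_phi_beta_region R.
  by apply/seteqP; split; [exact: Omega_subset_region|exact: region_subset_Omega].
by split; [exact: measurable_region|exact: volume_region].
Qed.
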